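(* Let $\mathfrak g$ be an even-dimensional (finite-dimensional) real Lie algebra with $1$-dimensional commutator ideal $\mathfrak g'=[\mathfrak g,\mathfrak g]$. Then: \begin{enumerate} \item $\mathfrak g$ is isomorphic to either $\mathfrak h_{2n+1}\times\mathbb R^{2k+1}$ (for some $n\ge 1$, $k\ge 0$) or $\mathfrak{aff}(\mathbb R)\times\mathbb R^{2k}$ (for some $k\ge 0$); \item all these Lie algebras carry abelian complex structures, and every complex structure on $\mathfrak g$ is abelian; \item there are exactly $\left[\frac n2\right]+1$ equivalence classes of complex structures on $\mathfrak h_{2n+1}\times\mathbb R^{2k+1}$; \item there is a unique complex structure on $\mathfrak{aff}(\mathbb R)\times\mathbb R^{2k}$ up to equivalence. \end{enumerate}
   Context: A complex structure on a real Lie algebra $\mathfrak g$ is a linear endomorphism $J$ with $J^2=-I$ and $J[x,y]-[Jx,y]-[x,Jy]-J[Jx,Jy]=0$ for all $x,y\in\mathfrak g$. It is abelian if $[Jx,Jy]=[x,y]$ for all $x,y$ (any endomorphism with $J^2=-I$ satisfying this is a complex structure). Two complex structures $J_1,J_2$ on $\mathfrak g$ are equivalent if there is an automorphism $\alpha$ of the Lie algebra $\mathfrak g$ with $J_2\alpha=\alpha J_1$. $\mathfrak h_{2n+1}$ is the $(2n+1)$-dimensional Heisenberg Lie algebra, with basis $e_1,\dots,e_{2n},z_0$ and nonzero brackets $[e_{2i-1},e_{2i}]=z_0$, $1\le i\le n$. $\mathfrak{aff}(\mathbb R)$ is the $2$-dimensional Lie algebra of the group of affine motions of $\mathbb R$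 (basis $e_1,e_2$ with $[e_1,e_2]=e_2$). $\mathbb R^m$ denotes the $m$-dimensional abelian Lie algebra, and $[\,\cdot\,]$ in (3) is the integer part. *)

(* Defs.v *)
From HB Require Import structures.
From mathcomp Require Import all_boot all_order all_algebra.
From mathcomp Require Import ring zify.
From mathcomp Require Import all_classical.
From mathcomp Require Import reals.

Set Implicit Arguments.
Unset Strict Implicit.
Unset Printing Implicit Defensive.

Import GRing.Theory.

Local Open Scope ring_scope.

(* Finite-dimensionality is part of vectType. *)
HB.mixin Record isLieAlgebra (R : fieldType) L of Vector R L := {
  bracket : L -> L -> L;
  bracket_linearl : forall y : L, linear (bracket ^~ y);
  bracket_linearr : forall x : L, linear (bracket x);
  bracketxx : forall x : L, bracket x x = 0;
  bracket_jacobi : forall x y z : L,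
    bracket x (bracket y z) + bracket y (bracket z x)
      + bracket z (bracket x y) = 0
}.

#[short(type="lieAlgType")]
HB.structure Definition LieAlgebra (R : fieldType) :=
  {L of isLieAlgebra R L & Vector R L}.

Section LieTheory.
Variables (R : fieldType) (L L1 L2 : lieAlgType R).

(* Same shape as the library's prodv; commutator_idealP below says that this
   is the smallest subspace containing all brackets. *)
Definition commutator_ideal : {vspace L} :=
  <<[seq bracket x y | x <- vbasis {:L}, y <- vbasis {:L}]>>%VS.

Lemma commutator_idealP (W : {vspace L}) :
  (forall x y : L, bracket x y \in W) <-> (commutator_ideal <= W)%VS.
Proof.
have big (f : L -> L) (u : {vspace L}) : linear f ->
    (forall i, f (vbasis {:L})`_i \in u) -> forall x, f x \in u.
  move=> lf fu x; pose fM := GRing.isLinear.Build _ _ _ _ f lf.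
  pose g : {linear L -> L} := HB.pack f fM.
  rewrite (coord_vbasis (memvf x)) -[f _]/(g _) linear_sum.
  by apply: memv_suml => i _; rewrite linearZ memvZ //; exact: fu.
have lie0 (x : L) : bracket x 0 = 0 /\ bracket 0 x = 0.
  split; first by have := bracket_linearr x (-1) 0 0;
    rewrite !scaleN1r oppr0 addr0 addNr.
  by have := bracket_linearl x (-1) 0 0; rewrite !scaleN1r oppr0 addr0 addNr.
split=> [br|sW x y].
  by apply/span_subvP => _ /allpairsP[p [_ _ ->]]; exact: br.
apply: (big (bracket ^~ y)) => [|i]; first exact: bracket_linearl.
apply: (big (bracket _)) => [|j]; first exact: bracket_linearr.
have [ilt|ige] := ltnP i (size (vbasis {:L})); last first.
  by rewrite (nth_default 0 ige) (lie0 _).2 mem0v.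
have [jlt|jge] := ltnP j (size (vbasis {:L})); last first.
  by rewrite (nth_default 0 jge) (lie0 _).1 mem0v.
apply: (subvP sW); apply: memv_span; apply/allpairsP.
by exists ((vbasis {:L})`_i, (vbasis {:L})`_j); split; rewrite ?mem_nth.
Qed.

Definition lie_isomorphism (f : 'Hom(L1, L2)) : Prop :=
  bijective f /\ forall x y : L1, f (bracket x y) = bracket (f x) (f y).

Definition complex_structure (J : 'End(L)) : Prop :=
  (forall x, J (J x) = - x) /\
  (forall x y, J (bracket x y) - bracket (J x) y - bracket x (J y)
                 - J (bracket (J x) (J y)) = 0).

Definition abelian_complex_structure (J : 'End(L)) : Prop :=
  complex_structure J /\
  forall x y : L, bracket (J x) (J y) = bracket x y.

End LieTheory.

Definition lie_isomorphic (R : fieldType) (L1 L2 : lieAlgType R) : Prop :=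
  exists f : 'Hom(L1, L2), lie_isomorphism f.

Definition equivalent_complex (R : fieldType) (L : lieAlgType R)
    (J1 J2 : 'End(L)) : Prop :=
  exists2 a : 'End(L), lie_isomorphism a & (J2 \o a)%VF = (a \o J1)%VF.

Definition complex_structure_classes (R : fieldType) (L : lieAlgType R) :
    set (set 'End(L)) :=
  ((fun J => [set J' | complex_structure J' /\ equivalent_complex J J'])
     @` [set J | complex_structure J])%classic.
Arguments complex_structure_classes {R} L.

Section ProductLie.
Variables (R : fieldType) (L1 L2 : lieAlgType R).
Implicit Types x y z : (L1 * L2)%type.

Definition prod_bracket x y : (L1 * L2)%type :=
  (bracket x.1 y.1, bracket x.2 y.2).

Fact prod_bracket_linearl y : linear (prod_bracket ^~ y).
Proof. by move=> a u v; congr (_, _); exact: bracket_linearl. Qed.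

Fact prod_bracket_linearr x : linear (prod_bracket x).
Proof. by move=> a u v; congr (_, _); exact: bracket_linearr. Qed.

Fact prod_bracketxx x : prod_bracket x x = 0.
Proof. by congr (_, _); exact: bracketxx. Qed.

Fact prod_bracket_jacobi x y z :
  prod_bracket x (prod_bracket y z) + prod_bracket y (prod_bracket z x)
    + prod_bracket z (prod_bracket x y) = 0.
Proof. by congr (_, _); exact: bracket_jacobi. Qed.

HB.instance Definition _ := isLieAlgebra.Build R (L1 * L2)%type
  prod_bracket_linearl prod_bracket_linearr prod_bracketxx prod_bracket_jacobi.

End ProductLie.

Definition abelian_lie (R : fieldType) (m : nat) : Type := 'rV[R]_m.

Section AbelianLie.
Variables (R : fieldType) (m : nat).
HB.instance Definition _ := Vector.on (abelian_lie R m).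

Implicit Types x y z : abelian_lie R m.

Definition abelian_bracket x y : abelian_lie R m := 0.

Fact abelian_bracket_linearl y : linear (abelian_bracket ^~ y).
Proof. by move=> a u v; rewrite scaler0 addr0. Qed.

Fact abelian_bracket_linearr x : linear (abelian_bracket x).
Proof. by move=> a u v; rewrite scaler0 addr0. Qed.

Fact abelian_bracketxx x : abelian_bracket x x = 0.
Proof. by []. Qed.

Fact abelian_bracket_jacobi x y z :
  abelian_bracket x (abelian_bracket y z)
    + abelian_bracket y (abelian_bracket z x)
    + abelian_bracket z (abelian_bracket x y) = 0.
Proof. by rewrite !addr0. Qed.

HB.instance Definition _ := isLieAlgebra.Build R (abelian_lie R m)
  abelian_bracket_linearl abelian_bracket_linearr abelian_bracketxx
  abelian_bracket_jacobi.

End AbelianLie.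

(* Coordinates (0-based) 2i and 2i+1, for i < n, are those along the
   mathematical e_(2i+1) and e_(2i+2); the last one is along z_0. *)
Definition heisenberg (R : fieldType) (n : nat) : Type := 'rV[R]_(n.*2.+1).

Section Heisenberg.
Variables (R : fieldType) (n : nat).
HB.instance Definition _ := Vector.on (heisenberg R n).

Implicit Types x y z : heisenberg R n.

Definition heisenberg_e (j : 'I_n.*2) : heisenberg R n :=
  delta_mx 0 (widen_ord (leqnSn _) j).
Definition heisenberg_z0 : heisenberg R n := delta_mx 0 ord_max.

Definition heisenberg_form (x y : 'rV[R]_(n.*2.+1)) : R :=
  \sum_(i < n) (x 0 (inord i.*2) * y 0 (inord i.*2.+1)
                - x 0 (inord i.*2.+1) * y 0 (inord i.*2)).

Definition heisenberg_bracket x y : heisenberg R n :=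
  heisenberg_form x y *: heisenberg_z0.

Fact heisenberg_bracket_linearl y : linear (heisenberg_bracket ^~ y).
Proof.
move=> a u v; rewrite /heisenberg_bracket scalerA -scalerDl; congr (_ *: _).
rewrite /heisenberg_form mulr_sumr -big_split; apply: eq_bigr => i _ /=.
by rewrite !mxE; ring.
Qed.

Fact heisenberg_bracket_linearr x : linear (heisenberg_bracket x).
Proof.
move=> a u v; rewrite /heisenberg_bracket scalerA -scalerDl; congr (_ *: _).
rewrite /heisenberg_form mulr_sumr -big_split; apply: eq_bigr => i _ /=.
by rewrite !mxE; ring.
Qed.

Fact heisenberg_bracketxx x : heisenberg_bracket x x = 0.
Proof.
rewrite /heisenberg_bracket /heisenberg_form big1 ?scale0r // => i _; ring.
Qed.

Fact heisenberg_form_z0 x a : heisenberg_form x (a *: heisenberg_z0) = 0.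
Proof.
apply: big1 => i _.
have lt1 : (i.*2.+1 < n.*2)%N by rewrite ltn_Sdouble.
have lt0 : (i.*2 < n.*2)%N by rewrite ltn_double.
rewrite !mxE -!val_eqE /= !inordK //; try exact: ltnW.
by rewrite (ltn_eqF lt1) (ltn_eqF lt0) !mulr0 subrr.
Qed.

Fact heisenberg_bracket_center x y z :
  heisenberg_bracket x (heisenberg_bracket y z) = 0.
Proof.
by rewrite {1}/heisenberg_bracket heisenberg_form_z0 scale0r.
Qed.

Fact heisenberg_bracket_jacobi x y z :
  heisenberg_bracket x (heisenberg_bracket y z)
    + heisenberg_bracket y (heisenberg_bracket z x)
    + heisenberg_bracket z (heisenberg_bracket x y) = 0.
Proof. by rewrite !heisenberg_bracket_center !addr0. Qed.

HB.instance Definition _ := isLieAlgebra.Build R (heisenberg R n)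
  heisenberg_bracket_linearl heisenberg_bracket_linearr heisenberg_bracketxx
  heisenberg_bracket_jacobi.

Lemma heisenberg_bracket_z0 x : bracket x heisenberg_z0 = 0.
Proof.
rewrite /bracket /= /heisenberg_bracket -[X in heisenberg_form x X]scale1r.
by rewrite heisenberg_form_z0 scale0r.
Qed.

Lemma heisenberg_bracket_e (j k : 'I_n.*2) : (j < k)%N ->
  bracket (heisenberg_e j) (heisenberg_e k) =
  if ~~ odd j && (k == j.+1 :> nat) then heisenberg_z0 else 0.
Proof.
move=> ltjk; rewrite /bracket /= /heisenberg_bracket.
rewrite (_ : heisenberg_form _ _ = (~~ odd j && (k == j.+1 :> nat))%:R); last first.
  have jn : (j./2 < n)%N by rewrite -ltn_double (leq_ltn_trans _ (ltn_ord j)) //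
    -[leqRHS]odd_double_half leq_addl.
  rewrite /heisenberg_form (bigD1 (Ordinal jn)) //= big1 ?addr0 => [|i ne].
    rewrite !mxE -!val_eqE /= !inordK ?ltnS ?ltn_Sdouble //; try lia.
    have -> : (j./2.*2 == k) = false by apply/eqP; lia.
    have -> : (j./2.*2 == j) = ~~ odd j by apply/eqP/idP; lia.
    rewrite mulr0 subr0 -natrM mulnb; congr (_%:R)%R; congr (nat_of_bool _).
    by case: (boolP (odd j)) => //= oj; apply/eqP/eqP; lia.
  have := ltn_ord i; have ne' : (i : nat) <> j./2 by move=> e; case/eqP: ne; apply: val_inj.
  move=> lti; rewrite !mxE -!val_eqE /= !inordK ?ltnS ?ltn_Sdouble //; try lia.
  have -> : (i.*2 == j) = false by apply/eqP; lia.
  have -> : (i.*2.+1 == j) = false by apply/eqP; lia.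
  by rewrite !mul0r subrr.
by case: ifP => _; rewrite ?scale1r ?scale0r.
Qed.

End Heisenberg.

(* Coordinates 0 and 1 are those along e_1 and e_2. *)
Definition aff (R : fieldType) : Type := 'rV[R]_2.

Section Aff.
Variable R : fieldType.
HB.instance Definition _ := Vector.on (aff R).

Implicit Types x y z : aff R.

Definition aff_e1 : aff R := delta_mx 0 0.
Definition aff_e2 : aff R := delta_mx 0 1.

Definition aff_form (x y : 'rV[R]_2) : R := x 0 0 * y 0 1 - x 0 1 * y 0 0.

Definition aff_bracket x y : aff R := aff_form x y *: aff_e2.

Fact aff_bracket_linearl y : linear (aff_bracket ^~ y).
Proof.
move=> a u v; rewrite /aff_bracket scalerA -scalerDl; congr (_ *: _).
by rewrite /aff_form !mxE; ring.
Qed.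

Fact aff_bracket_linearr x : linear (aff_bracket x).
Proof.
move=> a u v; rewrite /aff_bracket scalerA -scalerDl; congr (_ *: _).
by rewrite /aff_form !mxE; ring.
Qed.

Fact aff_bracketxx x : aff_bracket x x = 0.
Proof. by rewrite /aff_bracket /aff_form mulrC subrr scale0r. Qed.

Fact aff_bracket_jacobi x y z :
  aff_bracket x (aff_bracket y z) + aff_bracket y (aff_bracket z x)
    + aff_bracket z (aff_bracket x y) = 0.
Proof.
rewrite /aff_bracket -!scalerDl (_ : _ + _ = 0) ?scale0r //.
by rewrite /aff_form !mxE /=; ring.
Qed.

HB.instance Definition _ := isLieAlgebra.Build R (aff R)
  aff_bracket_linearl aff_bracket_linearr aff_bracketxx aff_bracket_jacobi.

Lemma aff_bracket_e1e2 : bracket aff_e1 aff_e2 = aff_e2.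
Proof.
rewrite /bracket /= /aff_bracket /aff_form !mxE /=.
by rewrite mulr1 mul0r subr0 scale1r.
Qed.

End Aff.

(* Main.v *)
(* Let z span g', so that [x, y] = w(x, y) z for an alternating form w. As z and
   J z are independent, the integrability of J forces w(J x, J y) = w(x, y):
   complex structures are abelian. Hence w splits, by a Gram-Schmidt argument,
   into hyperbolic planes <x, y> and a radical, and in the presence of J the
   planes can be taken of the form <x, J x> with w(x, J x) = 1 or -1. If z is
   central it lies in the radical, and the normal form yields the Heisenberg
   case, J being determined by the signature (p, q), p + q = n, of w(x, J x);
   automorphisms rescale z, hence preserve this signature up to swapping p and
   q. Otherwise Jacobi's identity forces w to have rank 2, the only plane being
   <z, J z>, which yields the affine case. *)
From HB Require Import structures.
Require Import Defs.
From mathcomp Require Import all_boot all_order all_algebra.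
From mathcomp Require Import ring lra zify.
From mathcomp Require Import all_classical reals.

Set Implicit Arguments.
Unset Strict Implicit.
Unset Printing Implicit Defensive.

Import Order.TTheory GRing.Theory Num.Theory.

Local Open Scope ring_scope.

(** All four claims are read off bases made of mutually commuting pairs (x, y), each carrying a
    scalar a with [x, y] = a z. Two such bases with the same list of scalars are matched by an
    isomorphism; if moreover y = J x in every pair, it intertwines the complex structures. For this
    z itself has to be matched, so it always heads the list; scalar 0 marks the pairs that fill the
    radical. Without J the partner y can be rescaled at will, and nonzero scalars can be made equal
    to 1. A pair (x, J x) changes its scalar only by squares, so a sign survives, and this sign is
    what separates the classes in the Heisenberg case. In the affine case it disappears, because z
    belongs to the only plane: replacing z by s z multiplies [J z, z] by s^2 but the unit of measure
    by s, so the scalar changes by s, which may be negative. *)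

Lemma basis_size (K : fieldType) (V : vectType K) (U : {vspace V}) (X : seq V) :
  basis_of U X -> size X = \dim U.
Proof. by move=> bX; rewrite (size_basis (X := in_tuple X)). Qed.

(** * Bilinearity of the bracket *)

Section Bracket.
Variables (R : fieldType) (L : lieAlgType R).
Implicit Types x y u v : L.

HB.instance Definition _ x :=
  GRing.isLinear.Build R L L _ (bracket x) (bracket_linearr x).

Lemma bracketC x y : bracket x y = - bracket y x.
Proof.
have Dl u v w : bracket (u + v) w = bracket u w + bracket v w.
  by rewrite -[u]scale1r bracket_linearl !scale1r.
have := bracketxx (x + y).
rewrite linearD /= !Dl !bracketxx add0r addr0 addrC => /eqP.
by rewrite addr_eq0 => /eqP.
Qed.

Lemma bracketDl x y u : bracket (x + y) u = bracket x u + bracket y u.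
Proof. by rewrite bracketC linearD /= opprD -!bracketC. Qed.

Lemma bracketZl a x u : bracket (a *: x) u = a *: bracket x u.
Proof. by rewrite bracketC linearZ /= -scalerN -bracketC. Qed.

Lemma bracketNl x u : bracket (- x) u = - bracket x u.
Proof. by rewrite -scaleN1r bracketZl scaleN1r. Qed.

Lemma bracket_span0 x (X : seq L) :
  {in X, forall u, bracket x u = 0} -> {in <<X>>%VS, forall u, bracket x u = 0}.
Proof.
move=> x0 u; suff /subvP/[apply] : (<<X>> <= lker (linfun (bracket x)))%VS.
  by rewrite memv_ker lfunE /= => /eqP.
by apply/span_subvP => v vX; rewrite memv_ker lfunE /= x0.
Qed.

End Bracket.

(** * Lists of mutually commuting pairs *)

Section DarbouxLists.
Variables (R : fieldType) (L : lieAlgType R).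
Implicit Types (p q : L * L * R) (t : seq (L * L * R)) (x y z u v : L).

Definition pair_vectors t : seq L := flatten [seq [:: p.1.1; p.1.2] | p <- t].

Definition commuting_pairs p q : bool :=
  [&& bracket p.1.1 q.1.1 == 0, bracket p.1.1 q.1.2 == 0,
      bracket p.1.2 q.1.1 == 0 & bracket p.1.2 q.1.2 == 0].

(* A triple (x, y, a) records a pair of vectors with [x, y] = a z. *)
Definition darboux z t : bool :=
  all (fun p => bracket p.1.1 p.1.2 == p.2 *: z) t
    && pairwise commuting_pairs t.

Lemma pair_vectors_cons p t :
  pair_vectors (p :: t) = [:: p.1.1, p.1.2 & pair_vectors t].
Proof. by []. Qed.

Lemma size_pair_vectors t : size (pair_vectors t) = (size t).*2.
Proof. by elim: t => // p t IHt; rewrite pair_vectors_cons /= IHt. Qed.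

Lemma pair_vectors_cat t1 t2 :
  pair_vectors (t1 ++ t2) = pair_vectors t1 ++ pair_vectors t2.
Proof. by rewrite /pair_vectors map_cat flatten_cat. Qed.

Lemma perm_pair_vectors t1 t2 :
  perm_eq t1 t2 -> perm_eq (pair_vectors t1) (pair_vectors t2).
Proof. by move=> p12; apply/perm_flatten/perm_map. Qed.

Lemma pair_vectorsP u t :
  reflect (exists2 p, p \in t & u = p.1.1 \/ u = p.1.2) (u \in pair_vectors t).
Proof.
apply: (iffP flattenP) => [[_ /mapP[p pt ->]]|[p pt up]].
  by rewrite !inE => /orP[]/eqP ->; exists p => //; [left|right].
exists [:: p.1.1; p.1.2]; first by apply/mapP; exists p.
by rewrite !inE; case: up => ->; rewrite eqxx ?orbT.
Qed.

Lemma mem_pair_fst p t : p \in t -> p.1.1 \in pair_vectors t.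
Proof. by move=> pt; apply/pair_vectorsP; exists p; [|left]. Qed.

Lemma mem_pair_snd p t : p \in t -> p.1.2 \in pair_vectors t.
Proof. by move=> pt; apply/pair_vectorsP; exists p; [|right]. Qed.

Lemma commuting_pairsC : symmetric commuting_pairs.
Proof.
move=> p q; have br0 x y : (bracket x y == 0) = (bracket y x == 0).
  by rewrite bracketC oppr_eq0.
rewrite /commuting_pairs (br0 p.1.1) (br0 p.1.1) (br0 p.1.2) (br0 p.1.2).
by congr (_ && _); rewrite andbCA.
Qed.

Lemma darboux_cons z p t : darboux z (p :: t) =
  [&& bracket p.1.1 p.1.2 == p.2 *: z, all (commuting_pairs p) t & darboux z t].
Proof. by rewrite /darboux /=; case: (_ == _) => //=; case: (all (commuting_pairs p) t); rewrite ?andbF. Qed.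

Lemma darboux_perm z t1 t2 : perm_eq t1 t2 -> darboux z t1 = darboux z t2.
Proof.
have sub s1 s2 : perm_eq s1 s2 -> darboux z s1 -> darboux z s2.
  move=> p12; rewrite /darboux (perm_all _ p12) => /andP[-> /=].
  apply: (catCA_perm_ind (P := fun s => pairwise commuting_pairs s) _ p12) => s3 s4 s5.
  rewrite !pairwise_cat !allrel_catr.
  have -> : allrel commuting_pairs s4 s3 = allrel commuting_pairs s3 s4.
    by rewrite allrelC; apply: eq_allrel => p q; rewrite commuting_pairsC.
  by move=> /and3P[/andP[-> ->] -> /and3P[-> -> ->]].
by move=> p12; apply/idP/idP; apply: sub; rewrite // perm_sym.
Qed.

Lemma darboux_cat z t1 t2 : darboux z (t1 ++ t2) =
  [&& darboux z t1, darboux z t2 & allrel commuting_pairs t1 t2].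
Proof.
rewrite /darboux all_cat pairwise_cat.
by case: (all _ t1); case: (all _ t2); case: (pairwise _ t1); case: (pairwise _ t2); case: (allrel _ t1 t2).
Qed.

Lemma darboux_filter z a t : darboux z t -> darboux z [seq p <- t | a p].
Proof.
by case/andP=> zt ct; rewrite /darboux all_filter pairwise_filter //
  andbT; apply: sub_all zt => p /= ->; rewrite implybT.
Qed.

Lemma pairwise_commuting_span p t u :
  all (commuting_pairs p) t -> u \in <<pair_vectors t>>%VS ->
  bracket p.1.1 u = 0 /\ bracket p.1.2 u = 0.
Proof.
move=> pt ut; split; apply: bracket_span0 ut => v /pair_vectorsP[q /(allP pt)];
  by case/and4P=> /eqP ? /eqP ? /eqP ? /eqP ? [] ->.
Qed.

End DarbouxLists.

(** * Isomorphisms obtained by matching two lists of pairs *)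

Section Isomorphism.
Variables (R : fieldType) (L1 L2 : lieAlgType R).
Implicit Types (f : 'Hom(L1, L2)).

Lemma map_pair_vectors f (t1 : seq (L1 * L1 * R)) :
  map f (pair_vectors t1) = pair_vectors [seq (f p.1.1, f p.1.2, p.2) | p <- t1].
Proof. by elim: t1 => // p t1 IHt; rewrite pair_vectors_cons /= IHt. Qed.

Lemma map_pair_vectors_eq f (t1 : seq (L1 * L1 * R)) (t2 : seq (L2 * L2 * R)) :
  unzip2 t1 = unzip2 t2 -> map f (pair_vectors t1) = pair_vectors t2 ->
  t2 = [seq (f p.1.1, f p.1.2, p.2) | p <- t1].
Proof.
elim: t1 t2 => [|p t1 IHt] [|[[x y] a] t2] //= [-> e12].
by rewrite !pair_vectors_cons /= => -[-> -> ft]; rewrite -(IHt t2).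
Qed.

(** Both sides are bilinear, so one variable is extended at a time. The separate map [h] covers two
    uses: [h = f] tests a morphism on generators, while [h] the identity and [f = J] tests
    [J x, J y] = [x, y]. *)
Lemma bracket_morph_span f (h : 'Hom(L1, L2)) (X : seq L1) :
  {in X &, forall x y, h (bracket x y) = bracket (f x) (f y)} ->
  {in <<X>>%VS &, forall x y, h (bracket x y) = bracket (f x) (f y)}.
Proof.
move=> fX.
have half x : {in X, forall y, h (bracket x y) = bracket (f x) (f y)} ->
    {in <<X>>%VS, forall y, h (bracket x y) = bracket (f x) (f y)}.
  move=> fx; pose g1 := (h \o linfun (bracket x))%VF.
  pose g2 := (linfun (bracket (f x)) \o f)%VF.
  have /span_lfunP g12 : {in X, g1 =1 g2}.
    by move=> y yX; rewrite !comp_lfunE !lfunE /= fx.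
  by move=> y /g12; rewrite !comp_lfunE !lfunE.
move=> x y xX /half; apply=> {}y yX; rewrite bracketC [RHS]bracketC linearN /=.
by congr (- _); apply: half xX => {}x xX; exact: fX.
Qed.

(** Inside a pair the brackets agree because the scalar is kept and [f z1 = z2]; across pairs both
    sides vanish. *)
Lemma darboux_map_morph f z1 z2 t1 :
  f z1 = z2 -> darboux z1 t1 ->
  darboux z2 [seq (f p.1.1, f p.1.2, p.2) | p <- t1] ->
  {in pair_vectors t1 &, forall x y, f (bracket x y) = bracket (f x) (f y)}.
Proof.
move=> fz; elim: t1 => // p t1 IHt; rewrite /= !darboux_cons.
case/and3P=> /eqP p1 c1 d1 /and3P[/eqP/= p2 c2 d2].
have {}IHt := IHt d1 d2.
have pt v : v \in pair_vectors t1 -> [/\ f (bracket p.1.1 v) = bracket (f p.1.1) (f v),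
    f (bracket p.1.2 v) = bracket (f p.1.2) (f v),
    f (bracket v p.1.1) = bracket (f v) (f p.1.1) &
    f (bracket v p.1.2) = bracket (f v) (f p.1.2)].
  move=> vt; have [v1 v2] := pairwise_commuting_span c1 (memv_span vt).
  have fvt : f v \in <<pair_vectors [seq (f p.1.1, f p.1.2, p.2) | p <- t1]>>%VS.
    by rewrite -map_pair_vectors memv_span ?map_f.
  have /= [fv1 fv2] := pairwise_commuting_span c2 fvt.
  by rewrite ![bracket v _]bracketC ![bracket (f v) _]bracketC v1 v2 fv1 fv2 !oppr0 linear0.
have p12 : f (bracket p.1.1 p.1.2) = bracket (f p.1.1) (f p.1.2).
  by rewrite p1 p2 linearZ /= fz.
move=> x y; rewrite pair_vectors_cons !inE.
case/or3P=> [/eqP->|/eqP->|xt]; case/or3P=> [/eqP->|/eqP->|yt] //; try by case: (pt _ yt).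
- by rewrite !bracketxx linear0.
- by rewrite bracketC [RHS]bracketC linearN /= p12.
- by rewrite !bracketxx linear0.
- by case: (pt _ xt).
- by case: (pt _ xt).
exact: IHt.
Qed.

Lemma darboux_isomorphism z1 z2 t1 t2 :
  basis_of {:L1} (pair_vectors t1) -> basis_of {:L2} (pair_vectors t2) ->
  darboux z1 t1 -> darboux z2 t2 ->
  head 0 (pair_vectors t1) = z1 -> head 0 (pair_vectors t2) = z2 ->
  unzip2 t1 = unzip2 t2 ->
  exists2 f : 'Hom(L1, L2), lie_isomorphism f &
    t2 = [seq (f p.1.1, f p.1.2, p.2) | p <- t1].
Proof.
move=> b1 b2 d1 d2 h1 h2 e12.
have st : size t1 = size t2 by rewrite -(size_map snd t1) -(size_map snd t2); congr size.
have [f0 /(_ (basis_free b1))] := linear_of_free (pair_vectors t1) (pair_vectors t2).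
rewrite !size_pair_vectors st => /(_ erefl) f0t.
pose f : 'Hom(L1, L2) := linfun f0.
have {}f0t : map f (pair_vectors t1) = pair_vectors t2.
  by rewrite -f0t; apply: eq_map => v; rewrite lfunE.
have ft := map_pair_vectors_eq e12 f0t.
have limgf : limg f = fullv.
  by rewrite -(span_basis b1) limg_span f0t (span_basis b2).
have kerf : lker f == 0%VS.
  rewrite -dimv_eq0; have := limg_ker_dim f fullv.
  rewrite capfv limgf -(basis_size b1) -(basis_size b2) !size_pair_vectors st.
  by move=> /eqP; rewrite -[X in _ == X]add0n eqn_add2r.
exists f => //; split.
  exists (f^-1)%VF; first exact: lker0_lfunK.
  by move=> v; rewrite limg_lfunVK ?limgf ?memvf.
move=> x y; apply: (@bracket_morph_span f f (pair_vectors t1));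
  rewrite ?(span_basis b1) ?memvf //.
apply: (@darboux_map_morph f z1 z2) => //; last by rewrite -ft.
(* The heads are corresponding basis vectors; for an empty basis both are the default 0. *)
by rewrite -h1 -h2 -f0t; case: (pair_vectors t1) => //=; rewrite linear0.
Qed.

End Isomorphism.

Lemma perm_swap2 (T : eqType) (x y : T) (s1 s2 : seq T) :
  perm_eq [:: x, y & s1 ++ s2] (s1 ++ [:: y, x & s2]).
Proof. by apply/permP => c; rewrite /= !count_cat /=; lia. Qed.

(** * Gram-Schmidt reduction of the bracket form, for an abstract choice of pairs *)

Section NormalForm.
Variables (R : fieldType) (L : lieAlgType R) (z : L).
Implicit Types (x y u v : L) (U S N : {vspace L}) (t : seq (L * L * R)).

Definition perp U x y : {vspace L} :=
  (U :&: lker (linfun (bracket x)) :&: lker (linfun (bracket y)))%VS.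

Lemma perpP U x y v :
  reflect [/\ v \in U, bracket x v = 0 & bracket y v = 0] (v \in perp U x y).
Proof.
rewrite !memv_cap !memv_ker !lfunE /= -andbA.
by apply: (iffP and3P) => -[-> /eqP-> /eqP->].
Qed.

(* Used with two choices of (P, Rel, E): even-dimensional subspaces, arbitrary
   pairs and {1} for the Lie algebra alone; J-stable subspaces, pairs (x, J x)
   and {1, -1} in the presence of a complex structure J. *)
Record pair_selection (P : pred {vspace L}) (Rel : rel L) (E : pred R) : Prop :=
  PairSelection {
    _ : 0 \notin E;
    _ : P 0%VS;
    _ : P fullv;
    _ : forall U x y, P U -> x \in U -> y \in U -> Rel x y ->
        bracket x y != 0 -> P (perp U x y);
    _ : forall U x y, P U -> x \in U -> y \in U -> bracket x y != 0 ->
        exists p : L * L * R, [/\ p.1.1 \in U, p.1.2 \in U, Rel p.1.1 p.1.2,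
          p.2 \in E & bracket p.1.1 p.1.2 = p.2 *: z];
    _ : forall S U x, P S -> P U -> (S <= U)%VS -> x \in U -> x \notin S ->
        exists y, [/\ y \in U, Rel x y, y \notin (<[x]> + S)%VS
          & P (<[y]> + (<[x]> + S))%VS] }.

Hypotheses (z_neq0 : z != 0) (bracket_line : forall x y, bracket x y \in <[z]>%VS).

(** The plane spanned by [x] and [y] is nondegenerate, hence a direct complement of its orthogonal
    in [U]. *)
Lemma perp_basis U x y (X : seq L) : x \in U -> y \in U -> bracket x y != 0 ->
  basis_of (perp U x y) X -> basis_of U [:: x, y & X].
Proof.
move=> xU yU xy0 bX; have [a xy] := vlineP _ _ (bracket_line x y).
have a0 : a != 0 by apply: contraNneq xy0 => a0; rewrite xy a0 scale0r.
have inX v : v \in <<X>>%VS -> [/\ v \in U, bracket x v = 0 & bracket y v = 0].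
  by rewrite (span_basis bX) => /perpP.
rewrite basisEfree !free_cons (basis_free bX) andbT -andbA; apply/and4P; split.
- apply: contra xy0; rewrite span_cons => /memv_addP[_ /vlineP[b ->]] [v /inX[_ _ yv] ->].
  by rewrite bracketC linearD /= linearZ /= bracketxx scaler0 add0r yv oppr0.
- by apply: contra xy0 => /inX[_ ->].
- apply/span_subvP => v; rewrite !inE => /or3P[/eqP->|/eqP->|] //.
  by move/memv_span/inX => [].
suff /dimvS/leq_trans : (U <= <<[:: x, y & X]>>)%VS by apply; exact: dim_span.
apply/subvP => v vU; have [c xv] := vlineP _ _ (bracket_line x v).
have [d yv] := vlineP _ _ (bracket_line y v).
(* With [x, y] = a z, [x, v] = c z and [y, v] = d z, the vector v + (d/a) x - (c/a) y is orthogonal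
   to both x and y. *)
have -> : v = - (d / a) *: x + ((c / a) *: y + (v + (d / a) *: x - (c / a) *: y)).
  by rewrite [(c / a) *: y + _]addrC subrK scaleNr [v + _]addrC addKr.
rewrite !span_cons memv_add ?memvZ ?memv_line // memv_add ?memvZ ?memv_line //.
rewrite (span_basis bX); apply/perpP; split.
- by rewrite !rpredD ?rpredN ?rpredZ.
- rewrite !(linearD, linearN, linearZ) /= bracketxx xv xy. 
  by rewrite scaler0 addr0 scalerN scalerA divfK // subrr.
rewrite !(linearD, linearN, linearZ) /= bracketxx [bracket y x]bracketC yv xy.
by rewrite oppr0 scaler0 addr0 scalerN scalerA divfK // subrr.
Qed.

Lemma darboux_abelian U t : {in U &, forall u v, bracket u v = 0} ->
  {subset pair_vectors t <= U} -> all (fun p => p.2 == 0) t -> darboux z t.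
Proof.
move=> U0; elim: t => // p t IHt; rewrite pair_vectors_cons /= => tU /andP[/eqP p0 t0].
have p1 : p.1.1 \in U by apply: tU; rewrite !inE eqxx.
have p2 : p.1.2 \in U by apply: tU; rewrite !inE eqxx orbT.
have {}tU : {subset pair_vectors t <= U} by move=> v vt; apply: tU; rewrite !inE vt !orbT.
rewrite darboux_cons U0 // p0 scale0r eqxx IHt // andbT /=.
apply/allP => q qt; rewrite /commuting_pairs !U0 ?eqxx //;
  by apply: tU; rewrite ?mem_pair_fst ?mem_pair_snd.
Qed.

Variables (P : pred {vspace L}) (Rel : rel L) (E : pred R).
Hypothesis sel : pair_selection P Rel E.

Local Notation related t := (all (fun p => Rel p.1.1 p.1.2) t).

(** Induction on the dimension: as long as some bracket in [U] is nonzero, a pair is split off and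
    its orthogonal remains. The last clause is what later places a central [z] in the degenerate
    part [N]. *)
Lemma nondegenerate_splitting U : P U -> exists t N,
  [/\ [/\ P N, (N <= U)%VS & forall X, basis_of N X -> basis_of U (pair_vectors t ++ X)],
      [/\ darboux z t, related t & all E (unzip2 t)],
      {in N &, forall u v, bracket u v = 0},
      {in pair_vectors t, forall u, {in N, forall v, bracket u v = 0}} &
      {in U, forall u, (forall v, bracket v u = 0) -> u \in N}].
Proof.
have [E0 _ _ Pperp Ppick _] := sel.
have [m] := ubnP (\dim U); elim: m U => // m IHm U /ltnSE Um PU.
have [[x [y [xU yU xy0]]]|U0] := pselect (exists x y, [/\ x \in U, y \in U & bracket x y != 0]);
  last first.
  exists [::], U; split=> // u v uU vU; apply/eqP/negPn/negP => uv0.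
  by apply: U0; exists u, v.
have {x y xU yU xy0}[[[x y] a]/= [xU yU xyR aE xy]] := Ppick _ _ _ PU xU yU xy0.
have a0 : a != 0 by apply: contraNneq E0 => a_eq0; rewrite a_eq0 in aE.
have xy0 : bracket x y != 0 by rewrite xy scaler_eq0 negb_or a0.
have bU X := perp_basis xU yU xy0 (X := X).
have ltU : (\dim (perp U x y) < m)%N.
  apply: leq_trans Um; have := basis_size (bU _ (vbasisP _)).
  by rewrite /= size_tuple => <-.
have [t [N [[PN sNU bN] [dt Rt Et] N0 tN NC]]] := IHm _ ltU (Pperp _ _ _ PU xU yU xyR xy0).
have tU : (<<pair_vectors t>> <= perp U x y)%VS.
  by have := span_basis (bN _ (vbasisP N)); rewrite span_cat => <-; exact: addvSl.
exists ((x, y, a) :: t), N; split=> //.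
- split=> // [|X /bN/bU //].
  by apply: subv_trans sNU _; apply/subvP => v /perpP[].
- rewrite darboux_cons /= xy eqxx dt Rt Et xyR (aE : E a) /= andbT; split=> //.
  apply/allP => q qt; have tU' v : v \in pair_vectors t -> v \in perp U x y.
    by move=> /memv_span; apply/subvP.
  have /tU'/perpP[_ q1 q1'] : q.1.1 \in pair_vectors t.
    by apply: mem_pair_fst.
  have /tU'/perpP[_ q2 q2'] : q.1.2 \in pair_vectors t.
    by apply: mem_pair_snd.
  by rewrite /commuting_pairs /= q1 q1' q2 q2' eqxx.
- move=> u; rewrite pair_vectors_cons !inE /= => /or3P[/eqP->|/eqP->|/tN //] v.
    by move=> /(subvP sNU)/perpP[].
  by move=> /(subvP sNU)/perpP[].
by move=> u uU uC; apply: NC => //; apply/perpP.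
Qed.

(** Induction on the codimension of [S]. The scalar 0 is a placeholder that asserts nothing about
    brackets; it becomes correct through [darboux_abelian] once the completed subspace is known to
    be abelian. *)
Lemma pair_completion S U (X : seq L) : P S -> P U -> (S <= U)%VS -> basis_of S X ->
  exists t, [/\ basis_of U (pair_vectors t ++ X), related t &
                all (fun p => p.2 == 0) t].
Proof.
have [_ _ _ _ _ Pext] := sel => PS PU.
have [m] := ubnP (\dim U - \dim S); elim: m S X PS => // m IHm S X PS mS SU bX.
have [US|/subvPn[x xU xS]] := boolP (U <= S)%VS.
  by exists [::]; split=> //=; have /eqP-> : U == S by rewrite eqEsubv US.
have [y [yU xy yS PS']] := Pext _ _ _ PS PU SU xU xS.
have bX' : basis_of (<[y]> + (<[x]> + S)) [:: y, x & X].
  rewrite /basis_of !span_cons (span_basis bX) eqxx /= !free_cons span_cons.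
  by rewrite (span_basis bX) yS xS (basis_free bX).
have S'U : (<[y]> + (<[x]> + S) <= U)%VS by rewrite !subv_add -!memvE yU xU.
have [|t [bt Rt t0]] := IHm _ _ PS' _ S'U bX'.
  rewrite -(basis_size bX') /= (basis_size bX); have := dimvS S'U.
  by rewrite -(basis_size bX') /= (basis_size bX) => dU; clear -mS dU; lia.
exists ((x, y, 0) :: t); split; rewrite /= ?xy ?eqxx //.
rewrite (perm_basis _ (Y := pair_vectors t ++ [:: y, x & X])) //.
exact: perm_swap2.
Qed.

Lemma central_normal_form : (forall v, bracket v z = 0) ->
  exists t0 t1 r, [/\ basis_of fullv (pair_vectors (t0 ++ t1)),
    head 0 (pair_vectors t0) = z, darboux z (t0 ++ t1), related (t0 ++ t1)
    & unzip2 t0 = nseq r.+1 0 /\ all E (unzip2 t1)].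
Proof.
move=> zC; have [_ P0 PL _ _ Pext] := sel.
have [t1 [N [[PN _ bN] [dt1 Rt1 Et1] N0 t1N NC]]] := nondegenerate_splitting PL.
have zN : z \in N by apply: NC; rewrite ?memvf.
have [|y [yN zy yz PS]] := Pext _ _ _ P0 PN (sub0v N) zN; first by rewrite memv0.
rewrite addv0 in yz PS.
have bS : basis_of (<[y]> + <[z]>) [:: y; z].
  by rewrite /basis_of span_cons span_seq1 eqxx /= free_cons span_seq1 yz seq1_free.
have [|t0 [bt0 Rt0 zt0]] := pair_completion PS PN _ bS.
  by rewrite subv_add -!memvE yN zN.
(* The radical is filled starting from [z] and a partner [y]; this first pair is the extra unit in
   [r.+1]. *)
pose t2 := (z, y, 0 : R) :: t0.
have bt2 : basis_of N (pair_vectors t2).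
  rewrite (perm_basis _ (Y := pair_vectors t0 ++ [:: y; z])) //.
  by rewrite pair_vectors_cons -[pair_vectors t0 in X in perm_eq X]cats0; exact: perm_swap2.
have t2N : {subset pair_vectors t2 <= N}.
  by move=> v /memv_span; rewrite (span_basis bt2).
exists t2, t1, (size t0); split=> //.
- rewrite pair_vectors_cat (perm_basis _ (Y := pair_vectors t1 ++ pair_vectors t2)).
    exact: bN.
  by rewrite perm_catC.
- rewrite darboux_cat dt1 (darboux_abelian N0) //= ?eqxx //.
  apply/allrelP => p q pt qt.
  have pN1 : p.1.1 \in N by exact/t2N/mem_pair_fst.
  have pN2 : p.1.2 \in N by exact/t2N/mem_pair_snd.
  have q1 : q.1.1 \in pair_vectors t1 by apply: mem_pair_fst.
  have q2 : q.1.2 \in pair_vectors t1 by apply: mem_pair_snd.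
  by rewrite commuting_pairsC /commuting_pairs !t1N // eqxx.
- by rewrite all_cat /= zy Rt0.
split=> //; rewrite /t2 /=; congr (_ :: _).
by elim: (t0) zt0 => //= p t IHt /andP[/eqP-> /IHt->].
Qed.

(** The plane of [z] and [y] is nondegenerate and its orthogonal is abelian, so null pairs fill the
    rest. The scalar -1 comes from listing [z] first: [z, y] = - z. *)
Lemma noncentral_normal_form y : Rel z y -> bracket y z = z ->
  {in perp fullv z y &, forall u v, bracket u v = 0} ->
  exists t r, [/\ basis_of fullv (pair_vectors t), head 0 (pair_vectors t) = z,
    darboux z t, related t & unzip2 t = -1 :: nseq r 0].
Proof.
move=> Rzy yz N0; have [_ P0 PL Pperp _ _] := sel.
have zy : bracket z y = - z by rewrite bracketC yz.
have zy0 : bracket z y != 0 by rewrite zy oppr_eq0.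
have PN := Pperp _ _ _ PL (memvf z) (memvf y) Rzy zy0.
have [t [bt Rt t0]] := pair_completion P0 PN (sub0v _) (nil_basis L).
rewrite cats0 in bt.
exists ((z, y, -1) :: t), (size t); split=> //.
- by rewrite pair_vectors_cons; apply: perp_basis; rewrite ?memvf.
- have tN : {subset pair_vectors t <= perp fullv z y}.
    by move=> v /memv_span; rewrite (span_basis bt).
  rewrite darboux_cons /= zy scaleN1r eqxx (darboux_abelian N0) //= andbT.
  apply/allP => q qt.
  have /tN/perpP[_ q1 q1'] : q.1.1 \in pair_vectors t.
    by apply: mem_pair_fst.
  have /tN/perpP[_ q2 q2'] : q.1.2 \in pair_vectors t.
    by apply: mem_pair_snd.
  by rewrite /commuting_pairs /= q1 q1' q2 q2' eqxx.
- by rewrite /= Rzy.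
congr (_ :: _); elim: (t) t0 => //= p s IHs /andP[/eqP-> /IHs->] //.
Qed.

End NormalForm.

(** * Choice of pairs in even-dimensional subspaces *)

Section EvenSelection.
Variables (R : fieldType) (L : lieAlgType R) (z : L).

Lemma dim_add_line (x : L) (S : {vspace L}) :
  x \notin S -> \dim (<[x]> + S) = (\dim S).+1.
Proof.
move=> xS; rewrite -(span_basis (vbasisP S)) -span_cons.
rewrite -(basis_size (X := x :: vbasis S)) /=; last first.
  by rewrite /basis_of eqxx free_cons (basis_free (vbasisP S)) (span_basis (vbasisP S)) xS.
by rewrite size_tuple (span_basis (vbasisP S)).
Qed.

Hypothesis bracket_line : forall x y, bracket x y \in <[z]>%VS.

Lemma even_selection : ~~ odd (\dim {:L}) ->
  pair_selection z (fun U => ~~ odd (\dim U)) (fun _ _ => true) (pred1 1).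
Proof.
move=> evL; split=> //.
- by rewrite !inE eq_sym oner_eq0.
- by rewrite dimv0.
- move=> U x y evU xU yU _ xy.
  have := basis_size (perp_basis bracket_line xU yU xy (vbasisP _)).
  by rewrite /= size_tuple => dU; move: evU; rewrite -dU /= negbK.
- move=> U x y _ xU yU xy0; have [a xy] := vlineP _ _ (bracket_line x y).
  have a0 : a != 0 by apply: contraNneq xy0 => a0; rewrite xy a0 scale0r.
  exists (x, a^-1 *: y, 1) => /=; rewrite rpredZ // inE eqxx; split=> //.
  by rewrite linearZ /= xy scalerA mulVf.
move=> S U x evS evU SU xU xS.
have dS := dim_add_line xS.
(* Parity supplies the partner: the odd-dimensional [<[x]> + S] cannot exhaust the even-dimensional
   [U]. *)
have : ~~ (U <= <[x]> + S)%VS.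
  apply/negP => US; have : U == (<[x]> + S)%VS.
    by rewrite eqEsubv US subv_add SU -memvE xU.
  by move=> /eqP UE; move: evU; rewrite UE dS /= evS.
case/subvPn => y yU yS; exists y; split=> //.
by rewrite (dim_add_line yS) dS /= negbK.
Qed.

End EvenSelection.

(** * Abelian complex structures *)

Section AbelianStructures.
Variables (R : fieldType) (L : lieAlgType R) (J : 'End(L)).

(** Invariance of the bracket gives [J x, y] = [J J x, J y] = - [x, J y], and the four terms of the
    integrability condition cancel in pairs. *)
Lemma abelian_complex_structureP : (forall x, J (J x) = - x) ->
  (forall x y, bracket (J x) (J y) = bracket x y) -> abelian_complex_structure J.
Proof.
move=> JJ Jb; split=> //; split=> // x y.
by rewrite Jb -[bracket (J x) y]Jb JJ bracketNl opprK addrK subrr.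
Qed.

Lemma abelian_bracketJ : abelian_complex_structure J ->
  forall x y, bracket (J x) y = - bracket x (J y).
Proof. by case=> -[JJ _] Jb x y; rewrite -Jb JJ bracketNl. Qed.

End AbelianStructures.

(** * Choice of pairs (x, J x) in J-stable subspaces *)

Section ComplexSelection.
Variables (R : rcfType) (L : lieAlgType R) (z : L) (J : 'End(L)).
Hypotheses (z_neq0 : z != 0) (bracket_line : forall x y, bracket x y \in <[z]>%VS).

(** J has no real eigenvalue, even modulo a stable [S]: applying J to J x = a x + s yields (1 + a^2)
    x = - (a s + J s), which lies in [S]. *)
Lemma complex_line_notin (S : {vspace L}) x : (forall v, J (J v) = - v) ->
  (J @: S <= S)%VS -> x \notin S -> J x \notin (<[x]> + S)%VS.
Proof.
move=> JJ JS; apply: contra => /memv_addP[_ /vlineP[a ->] [s sS Jx]].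
have a1 : 1 + a * a != 0 by apply: lt0r_neq0; nra.
have -> : x = - (1 + a * a)^-1 *: (a *: s + J s).
  apply: (scalerI a1); rewrite scalerA mulrN divff // scaleN1r.
  have := congr1 J Jx; rewrite linearD linearZ /= JJ Jx scalerDr scalerA => xE.
  by apply/eqP; rewrite -addr_eq0 scalerDl scale1r -addrA [X in x + X]addrA -xE subrr.
by rewrite rpredZ // rpredD ?rpredZ //; apply: (subvP JS); apply: memv_img.
Qed.

(* By polarization, [x, y] vanishes on a J-stable subspace as soon as all the
   [x, J x] do. *)
Lemma complex_selection : abelian_complex_structure J ->
  pair_selection z (fun U => (J @: U <= U)%VS) (fun x y => y == J x) (pred2 1 (-1)).
Proof.
move=> abJ; have [[JJ _] Jb] := abJ; have bJ := abelian_bracketJ abJ.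
have JU U v : (J @: U <= U)%VS -> v \in U -> J v \in U.
  by move=> JU vU; apply: (subvP JU); apply: memv_img.
split.
- by rewrite !inE negb_or !(eq_sym 0) oppr_eq0 oner_eq0.
- by rewrite limg0.
- exact: subvf.
- move=> U x y PU xU yU /eqP yE xy; apply/subvP => _ /memv_imgP[v /perpP[vU xv yv] ->].
  apply/perpP; split; first exact: JU.
    by apply/eqP; rewrite -oppr_eq0 -bJ -yE yv.
  by rewrite yE Jb.
- move=> U x y PU xU yU xy0.
  have [u uU uJ0] : exists2 u, u \in U & bracket u (J u) != 0.
    apply: contrapT => H; case/eqP: xy0.
    have H0 u : u \in U -> bracket u (J u) = 0.
      by move=> uU; apply/eqP/negPn/negP => uJ; apply: H; exists u.
    have : bracket x (J (J y)) *+ 2 = 0.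
      (* At [x + J y] the two cross terms are both equal to - [x, y]. *)
      have := H0 (x + J y) (rpredD xU (JU _ _ PU yU)).
      rewrite !(linearD, bracketDl) /= !H0 ?JU // add0r addr0.
      by rewrite [bracket (J y) (J x)]Jb [bracket y x]bracketC JJ linearN /= mulr2n.
    by move/eqP; rewrite -scaler_nat scaler_eq0 pnatr_eq0 /= JJ linearN oppr_eq0 => /eqP.
  have [c uc] := vlineP _ _ (bracket_line u (J u)).
  have c0 : c != 0 by apply: contraNneq uJ0 => c0; rewrite uc c0 scale0r.
  (* Scaling u by s multiplies the coefficient c of [u, J u] by s^2: its absolute value is absorbed
     and only its sign remains. *)
  pose s := (Num.sqrt `|c|)^-1.
  exists (s *: u, J (s *: u), Num.sg c) => /=; split=> //.
  - by rewrite rpredZ.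
  - by rewrite JU ?rpredZ.
  - by rewrite !inE; case: (sgrP c) c0 => //; rewrite ?eqxx ?orbT.
  rewrite bracketZl !linearZ /= uc !scalerA; congr (_ *: _).
  have -> : s * s * c = c / `|c|.
    by rewrite -expr2 exprVn sqr_sqrtr ?normr_ge0 // mulrC.
  by apply: (mulIf (_ : `|c| != 0)); rewrite ?normr_eq0 // divfK ?normr_eq0 // -numEsg.
move=> S U x PS PU SU xU xS; exists (J x); split=> //; first exact: JU.
  exact: complex_line_notin.
rewrite !limgD !limg_line JJ !subv_add -!memvE memvN.
have m1 : J x \in (<[J x]> + (<[x]> + S))%VS by rewrite memvE addvSl.
have m2 : x \in (<[J x]> + (<[x]> + S))%VS.
  by apply: (subvP (addvSr _ _)); rewrite memvE addvSl.
rewrite m1 m2 /=; apply: subv_trans PS _.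
exact: subv_trans (addvSr _ _) (addvSr _ _).
Qed.

Lemma complex_structure_abelian : complex_structure J -> abelian_complex_structure J.
Proof.
case=> JJ JN; apply: abelian_complex_structureP => // x y.
have [a Ea] := vlineP _ _ (bracket_line x y).
have [b Eb] := vlineP _ _ (bracket_line (J x) (J y)).
have [c Ec] := vlineP _ _ (bracket_line (J x) y).
have [d Ed] := vlineP _ _ (bracket_line x (J y)).
have := JN x y; rewrite Ea Eb Ec Ed !linearZ /=.
have [->//|ab] := eqVneq b a.
(* Integrability now reads (a - b) J z = (c + d) z, which for a <> b would put J z on the line of
   z. *)
move=> H; have : J z \in (<[z]> + 0)%VS.
  rewrite addv0; apply/vlineP; exists ((c + d) / (a - b)).
  apply: (scalerI (_ : a - b != 0)); first by rewrite subr_eq0 eq_sym.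
  rewrite scalerA mulrC divfK ?subr_eq0 1?eq_sym // scalerBl scalerDl.
  apply/eqP; rewrite -subr_eq0 -H; apply/eqP; rewrite opprD.
  by rewrite -!addrA; congr (_ + _); rewrite addrC -addrA !scalerN.
have := @complex_line_notin 0%VS z JJ.
by rewrite limg0 subvv memv0 z_neq0 => /(_ isT isT)/negP.
Qed.

End ComplexSelection.

(** * Complex structures and lists of pairs (x, J x) *)

Section ComplexDarboux.
Variables (R : fieldType) (L : lieAlgType R).
Implicit Types (t : seq (L * L * R)) (J : 'End(L)).

Definition adapted J t : bool := all (fun p => p.1.2 == J p.1.1) t.

(** J is the quarter turn x -> y -> - x in every pair. Inside a pair [J x, J y] = [y, - x] = [x, y],
    and across pairs both brackets vanish. *)
Lemma darboux_complex_structure z t :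
  basis_of fullv (pair_vectors t) -> darboux z t ->
  exists2 J, abelian_complex_structure J & adapted J t.
Proof.
move=> bt dt; have [f] := linear_of_free (pair_vectors t)
  (pair_vectors [seq (p.1.2, - p.1.1, p.2) | p <- t]).
move=> /(_ (basis_free bt)); rewrite !size_pair_vectors size_map => /(_ erefl) ft.
pose J : 'End(L) := linfun f; exists J; last first.
  rewrite /adapted; elim: t {bt dt} ft => //= p t IHt.
  by rewrite !pair_vectors_cons /= => -[fp _ /IHt ->]; rewrite lfunE /= fp eqxx.
have Jt p : p \in t -> J p.1.1 = p.1.2 /\ J p.1.2 = - p.1.1.
  elim: t {bt dt} ft => //= q t IHt; rewrite !pair_vectors_cons /= => -[f1 f2 ft].
  by rewrite inE => /orP[/eqP->|/(IHt ft) //]; rewrite !lfunE.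
apply: abelian_complex_structureP => [x|x y].
  have : (J \o J)%VF = (- \1)%VF.
    apply/(fullv_lfunP _ _ (span_basis bt)) => v /pair_vectorsP[p /Jt[J1 J2] vE].
    by case: vE => ->; rewrite comp_lfunE opp_lfunE id_lfunE ?J1 ?J2 // linearN /= ?J1.
  by move=> /lfunP/(_ x); rewrite comp_lfunE opp_lfunE id_lfunE.
have := @bracket_morph_span _ _ _ J \1%VF (pair_vectors t).
rewrite (span_basis bt) => H; rewrite -H ?memvf ?id_lfunE //.
move=> {}x {}y; rewrite id_lfunE {H bt ft}.
elim: t dt Jt => // p t IHt; rewrite darboux_cons => /and3P[_ pt dt] Jt.
have [J1 J2] := Jt p (mem_head _ _).
have {}IHt := IHt dt (fun q qt => Jt q (mem_behead (s := p :: t) qt)).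
have Jpt v : v \in pair_vectors t -> J v \in <<pair_vectors t>>%VS.
  case/pair_vectorsP=> q qt vq; have [q1 q2] := Jt q (mem_behead (s := p :: t) qt).
  by case: vq => ->; rewrite ?q1 ?q2 ?memvN memv_span ?mem_pair_fst ?mem_pair_snd.
have C v : v \in <<pair_vectors t>>%VS ->
    [/\ bracket p.1.1 v = 0, bracket p.1.2 v = 0, bracket v p.1.1 = 0 & bracket v p.1.2 = 0].
  by move=> /(pairwise_commuting_span pt)[v1 v2]; rewrite ![bracket v _]bracketC v1 v2 oppr0.
rewrite pair_vectors_cons !inE.
case/or3P=> [/eqP->|/eqP->|xt]; case/or3P=> [/eqP->|/eqP->|yt];
  rewrite ?J1 ?J2 ?linearN /= ?bracketNl ?linearN /= ?bracketxx ?oppr0 ?opprK //.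
- exact: bracketC.
- by have [-> _ _ _] := C _ (memv_span yt); have [_ -> _ _] := C _ (Jpt _ yt).
- exact: bracketC.
- by have [_ -> _ _] := C _ (memv_span yt); have [-> _ _ _] := C _ (Jpt _ yt); rewrite oppr0.
- by have [_ _ -> _] := C _ (memv_span xt); have [_ _ _ ->] := C _ (Jpt _ xt).
- by have [_ _ _ ->] := C _ (memv_span xt); have [_ _ -> _] := C _ (Jpt _ xt); rewrite oppr0.
exact: IHt.
Qed.

(** Exchanging the members of a pair negates its scalar and keeps its span; this produces every
    signature from a list of scalars 1. *)
Lemma darboux_swap z t1 t2 : darboux z (t1 ++ t2) ->
  darboux z (t1 ++ [seq (p.1.2, p.1.1, - p.2) | p <- t2]).
Proof.
have swap t : darboux z t -> darboux z [seq (p.1.2, p.1.1, - p.2) | p <- t].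
  elim: t => // p t IHt; rewrite /= !darboux_cons => /and3P[/eqP p12 pt /IHt->].
  rewrite /= bracketC p12 scaleNr eqxx andbT all_map; apply: sub_all pt => q /=.
  by case/and4P=> *; apply/and4P; split.
rewrite !darboux_cat => /and3P[-> /swap -> c12] /=.
apply/allrelP => p _ pt /mapP[q qt ->]; have /and4P[*] := allrelP c12 _ _ pt qt.
by apply/and4P; split.
Qed.

Lemma perm_swap_pairs t : perm_eq (pair_vectors t)
  (pair_vectors [seq (p.1.2, p.1.1, - p.2) | p <- t]).
Proof.
elim: t => // p t IHt; rewrite /= !pair_vectors_cons /=.
rewrite -[X in perm_eq X]/([:: p.1.1; p.1.2] ++ _).
rewrite -[X in perm_eq _ X]/([:: p.1.2; p.1.1] ++ _) perm_cat //.
by rewrite (perm_catC [:: p.1.1] [:: p.1.2]).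
Qed.

(** The isomorphism matching the lists commutes with the complex structures on first members because
    both lists are adapted, and on second members because J^2 = - I. *)
Lemma adapted_equivalent J1 J2 z1 z2 t1 t2 :
  (forall x, J1 (J1 x) = - x) -> (forall x, J2 (J2 x) = - x) ->
  adapted J1 t1 -> adapted J2 t2 ->
  basis_of fullv (pair_vectors t1) -> basis_of fullv (pair_vectors t2) ->
  darboux z1 t1 -> darboux z2 t2 ->
  head 0 (pair_vectors t1) = z1 -> head 0 (pair_vectors t2) = z2 ->
  unzip2 t1 = unzip2 t2 -> equivalent_complex J1 J2.
Proof.
move=> JJ1 JJ2 /allP a1 a2 b1 b2 d1 d2 h1 h2 e12.
have [f fiso ft] := darboux_isomorphism b1 b2 d1 d2 h1 h2 e12.
exists f => //; apply/(fullv_lfunP _ _ (span_basis b1)) => v /pair_vectorsP[p pt vE].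
have /eqP pJ := a1 p pt.
have /eqP fpJ : f p.1.2 == J2 (f p.1.1).
  have: (f p.1.1, f p.1.2, p.2) \in t2 by rewrite ft; apply/mapP; exists p.
  by move/(allP a2).
by case: vE => ->; rewrite !comp_lfunE /= -?fpJ -?pJ // fpJ JJ2 pJ JJ1 linearN.
Qed.

End ComplexDarboux.

(** * Number of null pairs *)

Section Counting.
Variables (R : fieldType) (L : lieAlgType R) (z : L).
Implicit Types (t : seq (L * L * R)) (a b : pred R).

Lemma dim_pair_filter a t : basis_of fullv (pair_vectors t) ->
  \dim <<pair_vectors [seq p <- t | a p.2]>> = (count a (unzip2 t)).*2.
Proof.
move=> /basis_free; rewrite (perm_free (Y := pair_vectors
  ([seq p <- t | a p.2] ++ [seq p <- t | ~~ a p.2]))).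
  rewrite pair_vectors_cat => /catl_free; rewrite /free => /eqP->.
  by rewrite size_pair_vectors size_filter count_map.
apply: perm_pair_vectors; rewrite perm_sym; exact/permPl/perm_filterC.
Qed.

(** Two subspaces meeting in 0 have total dimension at most that of [L], and each pair contributes
    2. This comparison serves both invariants, the number of null pairs and the number of positive
    ones. *)
Lemma count_pair_cap a b t1 t2 :
  basis_of fullv (pair_vectors t1) -> basis_of fullv (pair_vectors t2) ->
  (forall u, u \in <<pair_vectors [seq p <- t1 | a p.2]>>%VS ->
     u \in <<pair_vectors [seq p <- t2 | ~~ b p.2]>>%VS -> u = 0) ->
  (count a (unzip2 t1) <= count b (unzip2 t2))%N.
Proof.
move=> b1 b2 cap0.
have d1 := dim_pair_filter a b1; have d2 := dim_pair_filter (predC b) b2.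
have := dimv_sum_cap <<pair_vectors [seq p <- t1 | a p.2]>>
  <<pair_vectors [seq p <- t2 | ~~ b p.2]>>.
have -> : (<<pair_vectors [seq p <- t1 | a p.2]>> :&:
    <<pair_vectors [seq p <- t2 | ~~ b p.2]>> = 0)%VS.
  apply/eqP; rewrite -subv0; apply/subvP => u /memv_capP[u1 u2].
  by rewrite memv0 (cap0 u).
rewrite dimv0 addn0 d1 d2 => dU.
have := dimvS (subvf (<<pair_vectors [seq p <- t1 | a p.2]>> +
  <<pair_vectors [seq p <- t2 | ~~ b p.2]>>)).
rewrite dU -doubleD -(basis_size b2) size_pair_vectors leq_double.
by rewrite -(size_map snd t2) -(count_predC b) leq_add2r.
Qed.

Hypothesis z_neq0 : z != 0.

(** Testing [u] against one member of a pair kills its coefficient on the other member. *)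
Lemma nondegenerate_span t u : darboux z t -> all (fun c => c != 0) (unzip2 t) ->
  u \in <<pair_vectors t>>%VS -> {in pair_vectors t, forall v, bracket v u = 0} ->
  u = 0.
Proof.
elim: t u => [|p t IHt] u; first by rewrite span_nil memv0 => _ _ /eqP.
rewrite darboux_cons => /and3P[/eqP pz pt dt] /= /andP[p0 t0].
rewrite pair_vectors_cons !span_cons.
case/memv_addP=> _ /vlineP[a ->] [_ /memv_addP[_ /vlineP[b ->] [v vt ->]] ->] u0.
have [v1 v2] := pairwise_commuting_span pt vt.
have b0 : b = 0.
  have := u0 _ (mem_head _ _); rewrite !linearD !linearZ /= bracketxx v1 pz scaler0 add0r addr0.
  by rewrite scalerA => /eqP; rewrite scaler_eq0 (negPf z_neq0) orbF mulf_eq0 (negPf p0) orbF => /eqP.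
have a0 : a = 0.
  have := u0 p.1.2; rewrite !inE eqxx orbT => /(_ isT).
  rewrite !linearD !linearZ /= bracketxx v2 bracketC pz scaler0 !addr0 -scalerN scalerA.
  rewrite scalerN => /eqP; rewrite oppr_eq0.
  by rewrite scaler_eq0 (negPf z_neq0) orbF mulf_eq0 (negPf p0) orbF => /eqP.
rewrite a0 b0 !scale0r !add0r; apply: IHt => // w wt.
have := u0 w; rewrite !inE wt !orbT => /(_ isT).
by rewrite a0 b0 !scale0r !add0r.
Qed.

Lemma null_pair_central t p : darboux z t -> p \in t -> p.2 = 0 ->
  {in <<pair_vectors t>>%VS, forall v, bracket p.1.1 v = 0 /\ bracket p.1.2 v = 0}.
Proof.
move=> dt pt p0; have tE := perm_to_rem pt.
move: dt; rewrite (darboux_perm _ tE) darboux_cons p0 scale0r => /and3P[/eqP p12 cpt _].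
suff H i : i \in [:: p.1.1; p.1.2] ->
    {in <<pair_vectors t>>%VS, forall v, bracket i v = 0}.
  by move=> v vt; split; apply: H => //; rewrite !inE eqxx ?orbT.
move=> ip; apply: bracket_span0 => v; rewrite (perm_mem (perm_pair_vectors tE)).
rewrite pair_vectors_cons !inE; move: ip; rewrite !inE.
case/orP=> /eqP-> /or3P[/eqP->|/eqP->|/memv_span vt];
  rewrite ?bracketxx ?p12 //; try by have [] := pairwise_commuting_span cpt vt.
by rewrite bracketC p12 oppr0.
Qed.

End Counting.

(** Null pairs of one list span central vectors, and a central vector in the span of the nonnull
    pairs of the other list is 0. The reference vectors [z1] and [z2] may differ. *)
Lemma darboux_count0 (R : fieldType) (L : lieAlgType R) (z1 z2 : L)
    (t1 t2 : seq (L * L * R)) : z1 != 0 -> z2 != 0 ->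
  basis_of fullv (pair_vectors t1) -> basis_of fullv (pair_vectors t2) ->
  darboux z1 t1 -> darboux z2 t2 ->
  count (pred1 (0%R : R)) (unzip2 t1) = count (pred1 (0%R : R)) (unzip2 t2).
Proof.
have le y1 y2 (s1 s2 : seq (L * L * R)) : y2 != 0 ->
    basis_of fullv (pair_vectors s1) -> basis_of fullv (pair_vectors s2) ->
    darboux y1 s1 -> darboux y2 s2 ->
    (count (pred1 (0%R : R)) (unzip2 s1) <= count (pred1 (0%R : R)) (unzip2 s2))%N.
  move=> y2_neq0 b1 b2 d1 d2; apply: count_pair_cap => // u u1 u2.
  apply: (nondegenerate_span y2_neq0) u2 _; first exact: darboux_filter.
    by rewrite all_map; exact: filter_all.
  move=> v _; apply: bracket_span0 u1 => x.
  case/pair_vectorsP=> p; rewrite mem_filter => /andP[/eqP p0 ps].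
  have [|p1 p2] := null_pair_central d1 ps p0 (x := v).
    by rewrite (span_basis b1) memvf.
  by case=> ->; rewrite bracketC ?p1 ?p2 oppr0.
move=> z1_neq0 z2_neq0 b1 b2 d1 d2; apply/eqP; rewrite eqn_leq.
by rewrite (le z1 z2) ?(le z2 z1).
Qed.

(** * Signature of the form w(u, J u) *)

Section Signature.
Variables (R : realFieldType) (L : lieAlgType R) (z : L).
Hypothesis z_neq0 : z != 0.
Implicit Types (t : seq (L * L * R)) (J : 'End(L)).

(** An adapted list diagonalizes the form: the component a x + b J x of [u] along a pair contributes
    (a^2 + b^2) times the scalar of that pair. *)
Lemma adapted_form_sign J t u : (forall x, J (J x) = - x) ->
  adapted J t -> darboux z t -> u \in <<pair_vectors t>>%VS ->
  exists k, [/\ bracket u (J u) = k *: z,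
    all (fun c => 0 < c) (unzip2 t) -> 0 <= k /\ (u != 0 -> 0 < k) &
    all (fun c => c <= 0) (unzip2 t) -> k <= 0].
Proof.
move=> JJ; elim: t u => [|p t IHt] u.
  rewrite span_nil memv0 => _ _ /eqP->; exists 0.
  by rewrite linear0 linear0 scale0r eqxx.
rewrite /adapted /= darboux_cons => /andP[/eqP pJ Jt] /and3P[/eqP pz pt dt].
rewrite pair_vectors_cons !span_cons.
case/memv_addP=> _ /vlineP[a ->] [_ /memv_addP[_ /vlineP[b ->] [v vt ->]] ->].
have [k [vk kpos kneg]] := IHt v Jt dt vt.
have [v1 v2] := pairwise_commuting_span pt vt.
have Jvt : J v \in <<pair_vectors t>>%VS.
  have /subvP : (<<pair_vectors t>> <= J @^-1: <<pair_vectors t>>)%VS.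
    apply/span_subvP => w /pair_vectorsP[q qt wq]; rewrite -memv_preim.
    have /eqP qJ := allP Jt q qt.
    by case: wq => ->; rewrite ?qJ ?JJ -?qJ ?memvN memv_span ?mem_pair_snd ?mem_pair_fst.
  by move=> /(_ v vt); rewrite -memv_preim.
have [Jv1 Jv2] := pairwise_commuting_span pt Jvt.
exists ((a * a + b * b) * p.2 + k); split.
- rewrite !linearD !linearZ /= -pJ pJ JJ -pJ !bracketDl !bracketZl !(linearD, linearN, linearZ) /=.
  rewrite !bracketxx [bracket v p.1.1]bracketC [bracket v p.1.2]bracketC.
  rewrite v1 v2 Jv1 Jv2 [bracket p.1.2 _]bracketC pz vk.
  by rewrite !(oppr0, scaler0, add0r, addr0, scalerN, opprK) !scalerA -!scalerDl; congr (_ *: _); ring.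
- case/andP=> p0 t0; have [k0 k1] := kpos t0.
  have ab : 0 <= (a * a + b * b) * p.2.
    by rewrite mulr_ge0 ?(ltW p0) // addr_ge0 // -expr2 sqr_ge0.
  split=> [|u0]; first exact: addr_ge0.
  have [a0|a0] := eqVneq a 0; have [b0|b0] := eqVneq b 0.
  + by rewrite a0 b0 mul0r add0r mul0r add0r k1 //; move: u0; rewrite a0 b0 !scale0r !add0r.
  + by rewrite ltr_pwDl // mulr_gt0 // a0 mul0r add0r -expr2 exprn_even_gt0.
  + by rewrite ltr_pwDl // mulr_gt0 // b0 mul0r addr0 -expr2 exprn_even_gt0.
  by rewrite ltr_pwDl // mulr_gt0 // addr_gt0 // -expr2 exprn_even_gt0.
case/andP=> p0 t0; rewrite -[leRHS]addr0 lerD ?kneg //.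
by rewrite mulr_ge0_le0 // addr_ge0 // -expr2 sqr_ge0.
Qed.

(* Sylvester's law of inertia, by intersecting a positive definite subspace of
   one list with a negative semidefinite subspace of the other. *)
Lemma adapted_count_pos J t1 t2 : (forall x, J (J x) = - x) ->
  adapted J t1 -> adapted J t2 ->
  basis_of fullv (pair_vectors t1) -> basis_of fullv (pair_vectors t2) ->
  darboux z t1 -> darboux z t2 ->
  count (fun c => 0 < c) (unzip2 t1) = count (fun c => 0 < c) (unzip2 t2).
Proof.
move=> JJ; have le t1' t2' : adapted J t1' -> adapted J t2' ->
    basis_of fullv (pair_vectors t1') -> basis_of fullv (pair_vectors t2') ->
    darboux z t1' -> darboux z t2' ->
    (count (fun c => 0 < c)%R (unzip2 t1') <= count (fun c => 0 < c)%R (unzip2 t2'))%N.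
  move=> a1 a2 b1 b2 d1 d2; apply: count_pair_cap => // u u1 u2.
  have Ja t a : adapted J t -> adapted J [seq p <- t | a p].
    by move=> Jt; rewrite /adapted all_filter; apply: sub_all Jt => p /= ->; rewrite implybT.
  have [k1 [uk1 pos _]] := adapted_form_sign JJ (Ja _ _ a1) (darboux_filter _ d1) u1.
  have [k2 [uk2 _ neg]] := adapted_form_sign JJ (Ja _ _ a2) (darboux_filter _ d2) u2.
  have k12 : k1 = k2.
    have : (k1 - k2) *: z == 0 by rewrite scalerBl -uk1 -uk2 subrr.
    by rewrite scaler_eq0 (negPf z_neq0) orbF subr_eq0 => /eqP.
  apply/eqP/negPn/negP => u0.
  have [|_ /(_ u0)] := pos; first by rewrite all_map; exact: filter_all.
  rewrite k12 ltNge neg // all_map /=; apply/allP => p.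
  by rewrite mem_filter /= -leNgt => /andP[].
by move=> *; apply/eqP; rewrite eqn_leq !le.
Qed.

Lemma darboux_rescale (c : R) t : darboux (c *: z) t ->
  darboux z [seq (p.1.1, p.1.2, p.2 * c) | p <- t].
Proof.
case/andP=> zt ct; rewrite /darboux all_map pairwise_map; apply/andP; split=> //.
by apply: sub_all zt => p /= /eqP->; rewrite scalerA.
Qed.

Lemma pair_vectors_rescale (c : R) t :
  pair_vectors [seq (p.1.1, p.1.2, p.2 * c) | p <- t] = pair_vectors t.
Proof. by elim: t => // p t IHt; rewrite /= !pair_vectors_cons IHt. Qed.

Lemma equivalent_count_pos J1 J2 t1 t2 :
  (forall x y : L, bracket x y \in <[z]>%VS) -> (exists x y : L, bracket x y != 0) ->
  (forall x, J1 (J1 x) = - x) -> (forall x, J2 (J2 x) = - x) ->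
  adapted J1 t1 -> adapted J2 t2 ->
  basis_of fullv (pair_vectors t1) -> basis_of fullv (pair_vectors t2) ->
  darboux z t1 -> darboux z t2 -> equivalent_complex J1 J2 ->
  let pos t := count (fun c => 0 < c) (unzip2 t) in
  pos t2 = pos t1 \/ pos t2 = count (fun c => c < 0) (unzip2 t1).
Proof.
move=> bl [x [y xy0]] JJ1 JJ2 a1 a2 b1 b2 d1 d2 [f [[g fK gK] fb] fJ] pos.
(* An automorphism preserves the line of [z]; the factor is found by comparing f [x, y] with
   [f x, f y] for a nonzero bracket. *)
have [c fz] : exists c, f z = c *: z.
  have [a xy] := vlineP _ _ (bl x y).
  have a0 : a != 0 by apply: contraNneq xy0 => a0; rewrite xy a0 scale0r.
  have [b fxy] := vlineP _ _ (bl (f x) (f y)).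
  exists (a^-1 * b); rewrite -scalerA -fxy -fb xy linearZ /= scalerA mulVf //.
  by rewrite scale1r.
have c0 : c != 0.
  apply: contraNneq z_neq0 => c0; apply/eqP; apply: (can_inj fK).
  by rewrite fz c0 scale0r linear0.
pose t := [seq (f p.1.1, f p.1.2, p.2) | p <- t1].
have bt : basis_of fullv (pair_vectors t).
  have -> : fullv = limg f.
    apply/eqP; rewrite eqEsubv subvf andbT; apply/subvP => v _.
    by rewrite -(gK v) memv_img ?memvf.
  rewrite -map_pair_vectors; apply: limg_basis_of => //.
  apply/eqP; rewrite -subv0; apply/subvP => v; rewrite memv_cap memv_ker => /andP[_ /eqP fv].
  by rewrite memv0; apply/eqP/(can_inj fK); rewrite fv linear0.
(* The image of [t1] is a list for [c *: z]; measured against [z], all its scalars are multiplied by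
   [c], whose sign decides between the two alternatives. *)
have dt : darboux z [seq (p.1.1, p.1.2, p.2 * c) | p <- t].
  apply: darboux_rescale; rewrite -fz; case/andP: d1 => /allP zt1 ct1.
  rewrite /darboux all_map pairwise_map; apply/andP; split.
    by apply/allP => p /zt1 /eqP pz; rewrite /= -fb pz linearZ.
  apply: sub_pairwise ct1 => p q; rewrite /commuting_pairs /= -!fb.
  by case/and4P=> /eqP-> /eqP-> /eqP-> /eqP->; rewrite linear0 eqxx.
have := @adapted_count_pos J2 t2 [seq (p.1.1, p.1.2, p.2 * c) | p <- t] JJ2 a2.
rewrite pair_vectors_rescale => /(_ _ b2 bt d2 dt) posE; rewrite /pos posE.
  rewrite /unzip2 -!map_comp !count_map.
  have [c_pos|c_neg|c_eq] := ltrgt0P c; last by rewrite c_eq eqxx in c0.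
    by left; apply: eq_count => p /=; rewrite pmulr_lgt0.
  by right; apply: eq_count => p /=; rewrite nmulr_lgt0.
rewrite /adapted /t !all_map; apply: sub_all a1 => p /= /eqP ->.
by have /lfunP/(_ p.1.1) := fJ; rewrite !comp_lfunE /= => ->.
Qed.

End Signature.

(** * Consequences of a one-dimensional commutator ideal *)

Section OneDimensionalCommutator.
Variables (R : fieldType) (L : lieAlgType R).

Lemma commutator_line : \dim (commutator_ideal L) = 1%N ->
  exists z : L, [/\ z != 0, forall x y : L, bracket x y \in <[z]>%VS
    & exists x y : L, bracket x y != 0].
Proof.
move=> d1; pose z := vpick (commutator_ideal L).
have z0 : z != 0 by rewrite vpick0 -dimv_eq0 d1.
have zE : (<[z]> == commutator_ideal L)%VS.
  by rewrite eqEdim -memvE memv_pick dim_vline z0 d1.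
exists z; split=> //; first by rewrite (eqP zE); apply/commutator_idealP.
apply: contrapT => H; suff : (commutator_ideal L <= 0)%VS.
  by rewrite subv0 -dimv_eq0 d1.
apply/commutator_idealP => x y; rewrite memv0; apply/negPn/negP => xy.
by apply: H; exists x, y.
Qed.

Variable z : L.
Hypothesis bracket_line : forall x y, bracket x y \in <[z]>%VS.

(** The derivation [e, -] kills u and v, hence [u, v]; but it fixes [u, v], a multiple of z. *)
Lemma noncentral_perp_abelian e : bracket e z = z ->
  {in perp fullv z e &, forall u v, bracket u v = 0}.
Proof.
move=> ez u v /perpP[_ zu eu] /perpP[_ zv ev].
have [a uv] := vlineP _ _ (bracket_line u v).
have := bracket_jacobi e u v; rewrite uv linearZ /= ez.
rewrite [bracket v e]bracketC ev oppr0 eu !linear0.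
by rewrite !addr0.
Qed.

Lemma noncentral_scale : (exists v, bracket v z != 0) ->
  exists e, bracket e z = z.
Proof.
move=> [v vz]; have [a vzE] := vlineP _ _ (bracket_line v z).
have a0 : a != 0 by apply: contraNneq vz => a0; rewrite vzE a0 scale0r.
by exists (a^-1 *: v); rewrite bracketZl vzE scalerA mulVf // scale1r.
Qed.

End OneDimensionalCommutator.

(** * Normal forms with and without a complex structure *)

Section NormalForms.
Variables (R : rcfType) (L : lieAlgType R) (z : L).
Hypotheses (z_neq0 : z != 0) (bracket_line : forall x y, bracket x y \in <[z]>%VS).
Implicit Types (t : seq (L * L * R)) (J : 'End(L)).

Lemma complex_central_normal_form J : abelian_complex_structure J ->
  (forall v, bracket v z = 0) ->
  exists t r p q, [/\ basis_of fullv (pair_vectors t),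
    head 0 (pair_vectors t) = z, darboux z t, adapted J t
    & unzip2 t = nseq r.+1 0 ++ nseq p 1 ++ nseq q (-1)].
Proof.
move=> abJ zC; have sel := complex_selection bracket_line abJ.
have [t0 [t1 [r [bt ht dt Jt [e0 e1]]]]] := central_normal_form z_neq0 bracket_line sel zC.
(* Grouping the pairs by sign makes the list of scalars depend on the counts alone, so that lists
   with equal counts can be matched. *)
pose t1' := [seq p <- t1 | p.2 == 1] ++ [seq p <- t1 | p.2 != 1].
have tE : perm_eq (t0 ++ t1) (t0 ++ t1').
  by rewrite perm_cat2l perm_sym; apply/permPl/perm_filterC.
exists (t0 ++ t1'), r, (size [seq p <- t1 | p.2 == 1]),
  (size [seq p <- t1 | p.2 != 1]); split.
- by rewrite -(perm_basis _ (perm_pair_vectors tE)).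
- by move: ht e0; case: (t0).
- by rewrite -(darboux_perm _ tE).
- by rewrite /adapted -(perm_all _ tE).
rewrite /unzip2 !map_cat -/(unzip2 t0) e0; congr (_ ++ (_ ++ _)).
  by elim: (t1) => //= p t IHt; case: eqP => //= ->; rewrite IHt.
elim: (t1) e1 => //= p t IHt /andP[+ /IHt].
by case: eqP => //= _ /eqP -> ->.
Qed.

Lemma even_central_normal_form : ~~ odd (\dim {:L}) ->
  (forall v, bracket v z = 0) ->
  exists t r m, [/\ basis_of fullv (pair_vectors t),
    head 0 (pair_vectors t) = z, darboux z t & unzip2 t = nseq r.+1 0 ++ nseq m 1].
Proof.
move=> evL zC; have sel := even_selection bracket_line evL.
have [t0 [t1 [r [bt ht dt _ [e0 e1]]]]] := central_normal_form z_neq0 bracket_line sel zC.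
exists (t0 ++ t1), r, (size t1); split=> //.
  by move: ht e0; case: (t0).
rewrite /unzip2 map_cat -/(unzip2 t0) e0; congr (_ ++ _).
by elim: (t1) e1 => //= p t IHt /andP[/eqP-> /IHt->].
Qed.

Lemma even_noncentral_normal_form : ~~ odd (\dim {:L}) ->
  (exists v, bracket v z != 0) ->
  exists t r, [/\ basis_of fullv (pair_vectors t),
    head 0 (pair_vectors t) = z, darboux z t & unzip2 t = -1 :: nseq r 0].
Proof.
move=> evL /(noncentral_scale bracket_line)[e ez].
have sel := even_selection bracket_line evL.
have [//|t [r [bt ht dt _ tE]]] := noncentral_normal_form z_neq0 bracket_line sel _ ez
  (noncentral_perp_abelian bracket_line ez).
by exists t, r.
Qed.

End NormalForms.

(** Noncentrality only provides some e with [e, z] = z, whereas an adapted list pairs z with J z;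
    the crux is that [J z, z] is nonzero. *)
Lemma complex_noncentral_normal_form (R : rcfType) (L : lieAlgType R) (z : L)
    (J : 'End(L)) :
  z != 0 -> (forall x y, bracket x y \in <[z]>%VS) -> abelian_complex_structure J ->
  (exists v, bracket v z != 0) ->
  exists w t r, [/\ basis_of fullv (pair_vectors t),
    head 0 (pair_vectors t) = w, darboux w t, adapted J t
    & unzip2 t = -1 :: nseq r 0].
Proof.
move=> z0 bl abJ znC; have [e ez] := noncentral_scale bl znC.
have N0 := noncentral_perp_abelian bl ez.
have [[JJ _] Jb] := abJ; have bJ := abelian_bracketJ abJ.
have [a Jzz] := vlineP _ _ (bl (J z) z).
have a0 : a != 0.
  apply: contra_neq z0 => a0.
  move: Jzz; rewrite a0 scale0r => Jzz {a a0}.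
  have [c Jez] := vlineP _ _ (bl (J e) z).
  have [d eJe] := vlineP _ _ (bl e (J e)).
  have eJz : bracket e (J z) = - (c *: z) by rewrite -Jez bJ opprK.
  (* If [J z, z] = 0 and [J e, z] = c z, this identity becomes (1 + c^2) z = 0. *)
  have := bracket_jacobi e (J e) (J z).
  rewrite Jb [bracket (J z) e]bracketC eJz opprK eJe !linearZ /= !ez Jez Jzz.
  rewrite scaler0 addr0 scalerA -[X in X + _]scale1r -scalerDl => /eqP.
  rewrite scaler_eq0 => /orP[/eqP c1|/eqP //].
  have : 0 < 1 + c * c by nra.
  by rewrite c1 ltxx.
(* From [J z, z] = a z follows [J w, w] = a^-2 a z = w, whatever the sign of a. *)
pose w := a^-1 *: z; have w0 : w != 0 by rewrite scaler_eq0 invr_eq0 negb_or a0.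
have wl x y : bracket x y \in <[w]>%VS.
  have [b ->] := vlineP _ _ (bl x y); apply/vlineP; exists (b * a).
  by rewrite scalerA mulfK.
have Jww : bracket (J w) w = w.
  by rewrite !linearZ /= bracketZl Jzz [a^-1 *: (a *: z)]scalerA mulVf // scale1r.
have sel := complex_selection wl abJ.
have [//|t [r [bt ht dt Jt tE]]] := noncentral_normal_form w0 wl sel _ Jww
  (noncentral_perp_abelian wl Jww).
by exists w, t, r.
Qed.

(** * Standard lists of pairs for the Heisenberg products *)

Section StandardPairs.
Variable R : fieldType.

Lemma prod_rV_span (m1 m2 : nat) (W : {vspace ('rV[R]_m1 * 'rV[R]_m2)%type}) :
  (forall j, (delta_mx 0 j, 0) \in W) -> (forall j, (0, delta_mx 0 j) \in W) ->
  (fullv <= W)%VS.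
Proof.
move=> W1 W2; apply/subvP => -[x y] _.
have -> : (x, y) = (x, 0) + (0, y) :> ('rV[R]_m1 * 'rV[R]_m2)%type.
  by rewrite -[in LHS](addr0 x) -[in LHS](add0r y).
apply: rpredD.
  rewrite [x]row_sum_delta; apply: (big_ind (fun x => (x, 0) \in W)) => [|u v uW vW|j _].
  - exact: mem0v.
  - by rewrite -[0](addr0 0); exact: (rpredD uW vW).
  suff -> : (x 0 j *: delta_mx 0 j, 0) = x 0 j *: (delta_mx 0 j, 0) :> ('rV[R]_m1 * 'rV[R]_m2)%type by exact: memvZ.
  by apply/eqP; rewrite -pair_eqE /= scaler0 !eqxx.
rewrite [y]row_sum_delta; apply: (big_ind (fun y => (0, y) \in W)) => [|u v uW vW|j _].
- exact: mem0v.
- by rewrite -[0](addr0 0); exact: (rpredD uW vW).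
suff -> : (0, y 0 j *: delta_mx 0 j) = y 0 j *: (0, delta_mx 0 j) :> ('rV[R]_m1 * 'rV[R]_m2)%type by exact: memvZ.
  by apply/eqP; rewrite -pair_eqE /= scaler0 !eqxx.
Qed.

Section Heisenberg.
Variables n k : nat.
Local Notation L := (heisenberg R n * abelian_lie R k.*2.+1)%type.

Definition std_e (j : nat) : L := (delta_mx 0 (inord j), 0).
Definition std_f (j : nat) : L := (0, delta_mx 0 (inord j)).
Definition heisenberg_center : L := (heisenberg_z0 R n, 0).

(** The central vector is paired with the first of the 2k+1 abelian coordinates; the other 2k are
    paired among themselves. *)
Definition heisenberg_pairs : seq (L * L * R) :=
  (heisenberg_center, std_f 0, 0)
    :: [seq (std_f j.*2.+1, std_f j.*2.+2, 0) | j <- iota 0 k]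
    ++ [seq (std_e i.*2, std_e i.*2.+1, 1) | i <- iota 0 n].

Lemma heisenberg_product_bracket (u v : L) :
  bracket u v = heisenberg_form u.1 v.1 *: heisenberg_center.
Proof. by apply/eqP; rewrite -pair_eqE /= scaler0 !eqxx. Qed.

Lemma heisenberg_product_line (u v : L) : bracket u v \in <[heisenberg_center]>%VS.
Proof. by rewrite heisenberg_product_bracket memvZ // memv_line. Qed.

Lemma heisenberg_center_neq0 : heisenberg_center != 0.
Proof.
apply/negP; rewrite -pair_eqE /= => /andP[/eqP/matrixP/(_ 0 ord_max)].
by rewrite !mxE !eqxx => /eqP; rewrite oner_eq0.
Qed.

Lemma heisenberg_center_central (v : L) : bracket v heisenberg_center = 0.
Proof.
rewrite heisenberg_product_bracket -[X in heisenberg_form _ X]scale1r.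
by rewrite heisenberg_form_z0 scale0r.
Qed.

Lemma bracket_std_f (v : L) j : bracket v (std_f j) = 0.
Proof.
rewrite heisenberg_product_bracket -[X in heisenberg_form _ X](scale0r (heisenberg_z0 R n)).
by rewrite heisenberg_form_z0 scale0r.
Qed.

Lemma bracket_std_e i j : (i < j < n.*2)%N -> bracket (std_e i) (std_e j) =
  (~~ odd i && (j == i.+1))%:R *: heisenberg_center.
Proof.
case/andP=> ij jn; have im := ltn_trans ij jn.
have eE l (ln : (l < n.*2)%N) : (std_e l).1 = heisenberg_e R (Ordinal ln).
  rewrite /std_e /heisenberg_e /=; congr (delta_mx _ _); apply: val_inj.
  by rewrite /= inordK // ltnS ltnW.
have := @heisenberg_bracket_e R n (Ordinal im) (Ordinal jn) ij.
rewrite -!eE /= => br; apply/eqP; rewrite -pair_eqE /= scaler0 eqxx andbT.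
apply/eqP; rewrite [LHS]br; case: ifP => _; by rewrite ?scale1r ?scale0r.
Qed.

Lemma size_heisenberg_pairs : size heisenberg_pairs = (n + k).+1.
Proof. by rewrite /= size_cat !size_map !size_iota addnC. Qed.

Lemma unzip2_heisenberg_pairs : unzip2 heisenberg_pairs = nseq k.+1 0 ++ nseq n 1.
Proof.
rewrite /unzip2 /= map_cat -!map_comp; congr (_ :: (_ ++ _)).
  by rewrite -[k in RHS](size_iota 0); elim: (iota 0 k) => //= _ s ->.
by rewrite -[n in RHS](size_iota 0); elim: (iota 0 n) => //= _ s ->.
Qed.

Lemma darboux_heisenberg_pairs : darboux heisenberg_center heisenberg_pairs.
Proof.
have fv j (v : L) : bracket (std_f j) v = 0 by rewrite bracketC bracket_std_f oppr0.
have zv (v : L) : bracket heisenberg_center v = 0.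
  by rewrite bracketC heisenberg_center_central oppr0.
rewrite /heisenberg_pairs darboux_cons darboux_cat; apply/and3P; split.
- by rewrite /= zv scale0r.
- by apply/allP => p _; rewrite /commuting_pairs /= !zv !fv eqxx.
apply/and3P; split.
- rewrite /darboux; apply/andP; split.
    by apply/allP => _ /mapP[j _ ->]; rewrite /= fv scale0r.
  rewrite pairwise_map; apply: (@sub_pairwise _ ltn) => [i j _|].
    by rewrite /commuting_pairs /= !fv eqxx.
  by rewrite -(sorted_pairwise ltn_trans) iota_ltn_sorted.
- rewrite /darboux; apply/andP; split.
    apply/allP => _ /mapP[j + ->]; rewrite mem_iota add0n => /= jn.
    by rewrite bracket_std_e ?ltnSn ?ltn_Sdouble //= odd_double eqxx.
  rewrite pairwise_map; apply: (@sub_in_pairwise _ (mem (iota 0 n)) ltn).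
  - move=> i j; rewrite ![_ \in mem _]mem_iota !add0n /= => hi hj ij.
    have e0 : (j.*2 == i.*2.+1) = false by apply/eqP; lia.
    have e1 : (j.*2.+1 == i.*2.+1) = false by apply/eqP; lia.
    rewrite /commuting_pairs /= !bracket_std_e /= ?odd_double ?e0 ?e1 ?scale0r ?eqxx //; lia.
  - exact/allP.
  - by rewrite -(sorted_pairwise ltn_trans) iota_ltn_sorted.
by apply/allrelP => _ q /mapP[j _ ->] _; rewrite /commuting_pairs /= !fv eqxx.
Qed.

Lemma basis_heisenberg_pairs : basis_of fullv (pair_vectors heisenberg_pairs).
Proof.
rewrite basisEdim; apply/andP; split; last first.
  rewrite size_pair_vectors size_heisenberg_pairs dimvf.
  by rewrite -[leqRHS]/(1 * n.*2.+1 + 1 * k.*2.+1)%N; lia.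
have W1 (v : L) : v \in pair_vectors heisenberg_pairs ->
  v \in <<pair_vectors heisenberg_pairs>>%VS by exact: memv_span.
apply: prod_rV_span => j; apply: W1; apply/pair_vectorsP.
- have [jn|nj] := ltnP j n.*2; last first.
    exists (heisenberg_center, std_f 0, 0); first exact: mem_head.
    left; rewrite /= /heisenberg_center; congr (delta_mx _ _, _).
    by apply: val_inj; rewrite /=; apply/eqP; rewrite eqn_leq nj -ltnS ltn_ord.
  exists (std_e j./2.*2, std_e j./2.*2.+1, 1).
    rewrite inE mem_cat; apply/orP; right; apply/orP; right.
    apply/mapP; exists j./2 => //; rewrite mem_iota /= add0n; lia.
  have jE := odd_double_half j; rewrite /std_e /=.
  case: (odd j) jE => jE; [right|left]; congr (delta_mx _ _, _); apply: val_inj;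
    by rewrite /= inordK ?ltnS; lia.
have [j0|j0] := posnP j.
  exists (heisenberg_center, std_f 0, 0); first exact: mem_head.
  by right; rewrite /= /std_f; congr (_, delta_mx _ _); apply: val_inj; rewrite /= inordK.
exists (std_f j.-1./2.*2.+1, std_f j.-1./2.*2.+2, 0).
  rewrite inE mem_cat; apply/orP; right; apply/orP; left.
  apply/mapP; exists j.-1./2 => //; rewrite mem_iota /= add0n.
  have := ltn_ord j; lia.
have jE := odd_double_half j.-1; have jk := ltn_ord j; rewrite /std_f /=.
case: (odd j.-1) jE => jE; [right|left]; congr (_, delta_mx _ _); apply: val_inj;
  by rewrite /= inordK; lia.
Qed.

End Heisenberg.

End StandardPairs.

(** * Standard lists of pairs for the affine products *)

Section Affine.
Variables (R : fieldType) (k : nat).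
Local Notation L := (aff R * abelian_lie R k.*2)%type.

(** The row is given entrywise because [k.*2] may be 0, and then there is no index for [inord] to
    return. *)
Definition aff_f (j : nat) : L := (0, \row_(l < k.*2) (l == j :> nat)%:R).

(** The generator e_2 of the commutator ideal must come first, and [e_2, e_1] = - e_2 gives the
    scalar -1. *)
Definition aff_pairs : seq (L * L * R) :=
  ((aff_e2 R, 0), (aff_e1 R, 0), -1)
    :: [seq (aff_f j.*2, aff_f j.*2.+1, 0) | j <- iota 0 k].

Lemma aff_product_bracket (u v : L) :
  bracket u v = aff_form u.1 v.1 *: ((aff_e2 R, 0) : L).
Proof. by apply/eqP; rewrite -pair_eqE /= scaler0 !eqxx. Qed.

Lemma unzip2_aff_pairs : unzip2 aff_pairs = -1 :: nseq k 0.
Proof.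
rewrite /unzip2 /= -map_comp; congr (_ :: _).
by rewrite -[k in RHS](size_iota 0); elim: (iota 0 k) => //= _ s ->.
Qed.

Lemma darboux_aff_pairs : darboux ((aff_e2 R, 0) : L) aff_pairs.
Proof.
have vf (v : L) j : bracket v (aff_f j) = 0.
  by rewrite aff_product_bracket /aff_form !mxE !mulr0 subrr scale0r.
have fv j (v : L) : bracket (aff_f j) v = 0 by rewrite bracketC vf oppr0.
rewrite /aff_pairs darboux_cons; apply/and3P; split.
- rewrite aff_product_bracket /aff_form !mxE /=.
  by rewrite mul0r mul1r sub0r.
- by apply/allP => _ /mapP[j _ ->]; rewrite /commuting_pairs /= !vf eqxx.
rewrite /darboux; apply/andP; split.
  by apply/allP => _ /mapP[j _ ->]; rewrite /= fv scale0r.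
rewrite pairwise_map; apply: (@sub_pairwise _ ltn) => [i j _|].
  by rewrite /commuting_pairs /= !fv eqxx.
by rewrite -(sorted_pairwise ltn_trans) iota_ltn_sorted.
Qed.

Lemma aff_fE (j : 'I_k.*2) : aff_f j = (0, delta_mx 0 j).
Proof. by congr (_, _); apply/rowP => l; rewrite !mxE -val_eqE. Qed.

Lemma basis_aff_pairs : basis_of fullv (pair_vectors aff_pairs).
Proof.
rewrite basisEdim; apply/andP; split; last first.
  rewrite size_pair_vectors /= size_map size_iota dimvf.
  by rewrite -[leqRHS]/(1 * 2 + 1 * k.*2)%N; lia.
have W1 (v : L) : v \in pair_vectors aff_pairs -> v \in <<pair_vectors aff_pairs>>%VS.
  exact: memv_span.
apply: prod_rV_span => j; apply: W1; apply/pair_vectorsP.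
  exists ((aff_e2 R, 0), (aff_e1 R, 0), -1); first exact: mem_head.
  by case: j => [[|[|//]] ?]; [right|left]; congr (delta_mx _ _, _); exact: val_inj.
have jk := ltn_ord j; have jE := odd_double_half j.
exists (aff_f j./2.*2, aff_f j./2.*2.+1, 0).
  rewrite inE; apply/orP; right; apply/mapP; exists j./2 => //.
  by rewrite mem_iota /= add0n; lia.
rewrite -[(0, _)]aff_fE /=.
by case: (odd j) jE => jE; [right|left]; congr aff_f; exact: esym jE.
Qed.

End Affine.

(** * Classification of complex structures on the Heisenberg products *)

Section HeisenbergStructures.
Variables (R : rcfType) (n k : nat).
Local Notation L := (heisenberg R n * abelian_lie R k.*2.+1)%type.
Local Notation z := (heisenberg_center R n k).
Implicit Types (J : 'End(L)) (p q : nat).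

(** This is the signature of [J] measured against [w], a parameter because passing from z to - z
    exchanges p and q. *)
Definition heisenberg_type (w : L) J p q := exists t,
  [/\ basis_of fullv (pair_vectors t), head 0 (pair_vectors t) = w,
    darboux w t, adapted J t
  & unzip2 t = nseq k.+1 0 ++ nseq p 1 ++ nseq q (-1)].

(** Comparison with the standard list forces k+1 null pairs, and the dimension then forces p + q =
    n. *)
Lemma heisenberg_type_exists c J : c != 0 -> abelian_complex_structure J ->
  exists p q, (p + q)%N = n /\ heisenberg_type (c *: z) J p q.
Proof.
move=> c0 abJ; have w0 : c *: z != 0.
  by rewrite scaler_eq0 negb_or c0 heisenberg_center_neq0.
have wl (x y : L) : bracket x y \in <[c *: z]>%VS.
  have [a ->] := vlineP _ _ (heisenberg_product_line x y).
  by apply/vlineP; exists (a / c); rewrite scalerA divfK.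
have wC v : bracket v (c *: z) = 0 by rewrite linearZ /= heisenberg_center_central scaler0.
have [t [r [p [q [bt ht dt Jt tE]]]]] := complex_central_normal_form w0 wl abJ wC.
have bh := basis_heisenberg_pairs R n k; have dh := darboux_heisenberg_pairs R n k.
have := darboux_count0 w0 (heisenberg_center_neq0 R n k) bt bh dt dh.
have cnt a b (d : nat) : count (pred1 (0%R : R))
    (nseq d 0 ++ nseq a 1 ++ nseq b (-1)) = d.
  by rewrite !count_cat !count_nseq /= eqxx oppr_eq0 oner_eq0; lia.
rewrite tE unzip2_heisenberg_pairs cnt -[nseq n 1]cats0 (cnt n 0%N) => -[rk].
exists p, q; split; last by exists t; split; rewrite // tE rk.
have : size (pair_vectors t) = size (pair_vectors (heisenberg_pairs R n k)).
  by rewrite (basis_size bt) (basis_size bh).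
rewrite !size_pair_vectors -(size_map snd t) -/(unzip2 t) tE size_heisenberg_pairs.
rewrite !size_cat !size_nseq rk; lia.
Qed.

Lemma count_pos_signature d p q :
  count (fun c : R => 0 < c) (nseq d 0 ++ nseq p 1 ++ nseq q (-1)) = p.
Proof. by rewrite !count_cat !count_nseq /= ltxx ltr01 ltr0N1; lia. Qed.

Lemma count_neg_signature d p q :
  count (fun c : R => c < 0) (nseq d 0 ++ nseq p 1 ++ nseq q (-1)) = q.
Proof. by rewrite !count_cat !count_nseq /= ltxx ltr10 ltrN10; lia. Qed.

(** Some type relative to - z exists already. Negating its scalars returns to z, where Sylvester's
    law identifies its negative count with p. *)
Lemma heisenberg_type_opp J p q : abelian_complex_structure J -> (p + q)%N = n ->
  heisenberg_type z J p q -> heisenberg_type (-1 *: z) J q p.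
Proof.
move=> abJ pq [t [bt ht dt Jt tE]].
have [|p' [q' [pq' tJ']]] := heisenberg_type_exists (c := -1) _ abJ.
  by rewrite oppr_eq0 oner_eq0.
have [t' [bt' _ dt' Jt' tE']] := tJ'.
have := @adapted_count_pos _ _ _ (heisenberg_center_neq0 R n k) J t
  [seq (x.1.1, x.1.2, x.2 * -1) | x <- t'] abJ.1.1 Jt.
rewrite pair_vectors_rescale => /(_ _ bt bt' dt (darboux_rescale dt')).
rewrite /adapted all_map => /(_ Jt').
rewrite {1}tE count_pos_signature /unzip2 -map_comp count_map.
rewrite -(count_map snd (fun c : R => 0 < c * -1)) -/(unzip2 t').
have -> : count (fun c : R => 0 < c * -1) (unzip2 t') = q'.
  rewrite -(count_neg_signature k.+1 p' q') -tE'; apply: eq_count => c /=.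
  by rewrite mulrN1 oppr_gt0.
by move=> pE; rewrite pE; have -> : q = p' by lia.
Qed.

Lemma heisenberg_equivalentP J1 J2 p1 q1 p2 q2 : (0 < n)%N ->
  abelian_complex_structure J1 -> abelian_complex_structure J2 ->
  (p1 + q1)%N = n -> (p2 + q2)%N = n ->
  heisenberg_type z J1 p1 q1 -> heisenberg_type z J2 p2 q2 ->
  equivalent_complex J1 J2 <-> p2 = p1 \/ p2 = q1.
Proof.
move=> n0 ab1 ab2 pq1 pq2 T1 T2.
have [t1 [b1 h1 d1 a1 E1]] := T1; have [t2 [b2 h2 d2 a2 E2]] := T2.
have JJ1 := ab1.1.1; have JJ2 := ab2.1.1.
split.
  move=> /(equivalent_count_pos (heisenberg_center_neq0 R n k)
    (@heisenberg_product_line R n k) _ JJ1 JJ2 a1 a2 b1 b2 d1 d2).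
  rewrite /= E1 E2 !count_pos_signature count_neg_signature; apply.
  exists (std_e R n k 0), (std_e R n k 1).
  by rewrite bracket_std_e ?double_gt0 //= ?scale1r ?heisenberg_center_neq0 //; lia.
case=> p21.
  by apply: adapted_equivalent b1 b2 d1 d2 h1 h2 _ => //; rewrite E1 E2 p21; have -> : q2 = q1 by lia.
(* When p2 = q1, the list of [J2] is taken relative to - z, where its signature becomes that of
   [J1]; the resulting automorphism sends z to - z. *)
have [t [b h d a E]] := heisenberg_type_opp ab2 pq2 T2.
apply: adapted_equivalent b1 b d1 d h1 h _ => //; rewrite E1 E p21.
by have -> : q2 = p1 by lia.
Qed.

Lemma heisenberg_type_realized p q : (p + q)%N = n ->
  exists2 J, abelian_complex_structure J & heisenberg_type z J p q.
Proof.
move=> pq; pose t := heisenberg_pairs R n k.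
(* The k+1 null pairs and p hyperbolic ones are kept; swapping the last q turns their scalars into
   -1. *)
pose t1 := take (k.+1 + p) t; pose t2 := drop (k.+1 + p) t.
have tE : t = t1 ++ t2 by rewrite cat_take_drop.
pose t' := t1 ++ [seq (x.1.2, x.1.1, - x.2) | x <- t2].
have dt' : darboux z t'.
  by apply: darboux_swap; rewrite -tE; exact: darboux_heisenberg_pairs.
have bt' : basis_of fullv (pair_vectors t').
  rewrite -(perm_basis (X := pair_vectors t)); first exact: basis_heisenberg_pairs.
  by rewrite tE !pair_vectors_cat perm_cat2l perm_swap_pairs.
have [J abJ Jt'] := darboux_complex_structure bt' dt'.
exists J => //; exists t'; split=> //.
have -> : unzip2 t' = unzip2 t1 ++ map -%R (unzip2 t2).
  by rewrite /unzip2 map_cat -!map_comp.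
rewrite /t1 /t2 /unzip2 map_take map_drop -/(unzip2 t) unzip2_heisenberg_pairs.
rewrite -pq nseqD catA take_size_cat ?drop_size_cat ?size_cat ?size_nseq //.
by rewrite -catA map_nseq.
Qed.

Lemma heisenberg_classes_card : (0 < n)%N ->
  (complex_structure_classes L #= `I_((n %/ 2).+1)%N)%card.
Proof.
move=> n0.
have ab J : complex_structure J -> abelian_complex_structure J.
  by apply: complex_structure_abelian (@heisenberg_product_line R n k);
    exact: heisenberg_center_neq0.
have typ J : complex_structure J -> exists p q, (p + q)%N = n /\ heisenberg_type z J p q.
  move=> /ab /(heisenberg_type_exists (oner_neq0 R)) [p [q [pq]]].
  by rewrite scale1r => T; exists p, q.
have /boolp.choice[Js JsP] i : exists J, (i <= n)%N ->
    abelian_complex_structure J /\ heisenberg_type z J i (n - i)%N.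
  have [ni|ni] := leqP i n; last by exists 0.
  by have [J] := heisenberg_type_realized (subnKC ni); exists J.
pose cls J := [set J' | complex_structure J' /\ equivalent_complex J J']%classic.
(* An unordered pair {p, q} with p + q = n is represented by its smaller member, which ranges from 0
   to the integer part of n/2. *)
have -> : complex_structure_classes L = ((cls \o Js) @` `I_(n %/ 2).+1)%classic.
  apply/seteqP; split=> [_ [J cJ <-]|_ [i ni <-]]; last first.
    exists (Js i) => //; have [|abi _] := JsP i; last exact: abi.1.
    by move: ni => /= ni; lia.
  have [p [q [pq T]]] := typ J cJ.
  have [i [iP ipq]] : exists i, (i <= n %/ 2)%N /\ (i = p \/ i = q).
    have [pq'|qp'] := leqP p q; [exists p|exists q]; split; [lia|by left|lia|by right].
  exists i => //=; have [|abi Ti] := JsP i; first by lia.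
  have ini : (i + (n - i))%N = n by lia.
  (* The two classes are compared member by member through types, in place of transitivity of the
     equivalence. *)
  apply/seteqP; split=> J' [cJ' eJ]; split=> //;
    have [p' [q' [pq' T']]] := typ J' cJ'.
    have H := (heisenberg_equivalentP n0 abi (ab _ cJ') ini pq' Ti T').1 eJ.
    by apply: (heisenberg_equivalentP n0 (ab _ cJ) (ab _ cJ') pq pq' T T').2; lia.
  have H := (heisenberg_equivalentP n0 (ab _ cJ) (ab _ cJ') pq pq' T T').1 eJ.
  by apply: (heisenberg_equivalentP n0 abi (ab _ cJ') ini pq' Ti T').2; lia.
(* Equal classes give j = i or j = n - i; as both are at most n/2, the second case also yields i =
   j. *)
apply: inj_card_eq => i j; rewrite !inE /= => ni nj ij.
have [|abi Ti] := JsP i; first by lia.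
have [|abj Tj] := JsP j; first by lia.
have ini : (i + (n - i))%N = n by lia.
have jnj : (j + (n - j))%N = n by lia.
have : cls (Js j) (Js j).
  split; first exact: abj.1.
  by apply: (heisenberg_equivalentP n0 abj abj jnj jnj Tj Tj).2; left.
rewrite -[cls (Js j)]ij => -[_].
by move=> /(heisenberg_equivalentP n0 abi abj ini jnj Ti Tj).1; lia.
Qed.

End HeisenbergStructures.

Theorem proposition2p2 (R : realType) :
  (forall g : lieAlgType R,
     ~~ odd (\dim {:g}) -> \dim (commutator_ideal g) = 1%N ->
     ((exists n k : nat, (1 <= n)%N /\
         lie_isomorphic g (heisenberg R n * abelian_lie R (k.*2.+1))%type) \/
      (exists k : nat,
         lie_isomorphic g (aff R * abelian_lie R k.*2)%type)) /\
     (forall J : 'End(g),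
        complex_structure J -> abelian_complex_structure J)) /\
  (forall n k : nat, (1 <= n)%N ->
     exists J : 'End((heisenberg R n * abelian_lie R (k.*2.+1))%type),
       abelian_complex_structure J) /\
  (forall k : nat,
     exists J : 'End((aff R * abelian_lie R k.*2)%type),
       abelian_complex_structure J) /\
  (forall n k : nat, (1 <= n)%N ->
     (complex_structure_classes
        (heisenberg R n * abelian_lie R (k.*2.+1))%type
      #= `I_((n %/ 2).+1)%N)%card) /\
  (forall k : nat,
     exists J : 'End((aff R * abelian_lie R k.*2)%type),
       complex_structure J /\
       forall J' : 'End((aff R * abelian_lie R k.*2)%type),
         complex_structure J' -> equivalent_complex J J').
Proof.
split=> [g evg dg|].
  have [z [z0 zl zn]] := commutator_line dg; split; last first.
    by move=> J; exact: complex_structure_abelian z0 zl.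
  have [zC|znC] := pselect (forall v, bracket v z = 0); last first.
    have [|t [r [bt ht dt tE]]] := even_noncentral_normal_form z0 zl evg.
      by apply: contrapT => H; apply: znC => v; apply/eqP/negPn/negP => vz; apply: H; exists v.
    right; exists r; have [|f fiso _] := darboux_isomorphism bt (basis_aff_pairs R r)
      dt (darboux_aff_pairs R r) ht erefl.
      by rewrite tE unzip2_aff_pairs.
    by exists f.
  have [t [r [m [bt ht dt tE]]]] := even_central_normal_form z0 zl evg zC.
  left; exists m, r.
  have [|f [fbij fb] _] := darboux_isomorphism bt (basis_heisenberg_pairs R m r)
    dt (darboux_heisenberg_pairs R m r) ht erefl.
    by rewrite tE unzip2_heisenberg_pairs.
  split; last by exists f.
  (* For m = 0 the model would be abelian, against the nonzero bracket in [g]. *)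
  case: m f fbij fb {tE} => // f fbij fb; have [x [y]] := zn.
  case/eqP; apply: (bij_inj fbij); rewrite fb linear0.
  by rewrite heisenberg_product_bracket /heisenberg_form big_ord0 scale0r.
split=> [n k n1|].
  by have [J abJ _] := heisenberg_type_realized R k (addn0 n); exists J.
have affJ k : exists2 J : 'End((aff R * abelian_lie R k.*2)%type),
    abelian_complex_structure J & adapted J (aff_pairs R k).
  by apply: darboux_complex_structure (darboux_aff_pairs R k); exact: basis_aff_pairs.
split=> [k|]; first by have [J abJ _] := affJ k; exists J.
split=> [n k n1|k]; first exact: heisenberg_classes_card.
have [J abJ Ja] := affJ k; exists J; split; first exact: abJ.1.
move=> J' cJ'.
pose z : (aff R * abelian_lie R k.*2)%type := (aff_e2 R, 0).
have z0 : z != 0.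
  apply/negP; rewrite -pair_eqE /= => /andP[/eqP/matrixP/(_ 0 1)].
  by rewrite !mxE !eqxx => /eqP; rewrite oner_eq0.
have zl (x y : (aff R * abelian_lie R k.*2)%type) : bracket x y \in <[z]>%VS.
  by rewrite aff_product_bracket memvZ // memv_line.
have znC : exists v : (aff R * abelian_lie R k.*2)%type, bracket v z != 0.
  exists (aff_e1 R, 0); rewrite aff_product_bracket /aff_form !mxE /=.
  by rewrite mulr1 mul0r subr0 scale1r.
have abJ' := complex_structure_abelian z0 zl cJ'.
(* The list for [J'] is headed by a multiple [w] of [z], so the equivalence built below sends [z] to
   [w]. *)
have [w [t [r [bt ht dt Jt tE]]]] := complex_noncentral_normal_form z0 zl abJ' znC.
have ba := basis_aff_pairs R k.
have rk : r = k.
  have : size (pair_vectors t) = size (pair_vectors (aff_pairs R k)).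
    by rewrite (basis_size bt) (basis_size ba).
  rewrite !size_pair_vectors -(size_map snd t) -/(unzip2 t) tE /= size_nseq.
  by rewrite size_map size_iota; lia.
apply: adapted_equivalent ba bt (darboux_aff_pairs R k) dt erefl ht _ => //;
  [exact: abJ.1.1 | exact: abJ'.1.1 |].
by rewrite tE unzip2_aff_pairs rk.
Qed.
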